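(* Let $k\ge 2$ be an integer and let $n>m$ be non-negative integers. Let $\phi(z)=\sum_{i=0}^n a_i\bar z^i$ and $\zeta(z)=\sum_{j=0}^m b_j\bar z^j$ be functions in $L^\infty(\mathbb{D},dA)$ with complex coefficients $a_i,b_j$. Write $n=kp_1+r_1$ and $m=kp_2+r_2$ with integers $p_1,p_2\ge 0$ and $0\le r_1,r_2<k$, and suppose that $b_{kp_2}\ne 0$ and $b_m\ne 0$. Then the $k$th-order slant little Hankel operators $S_\phi^k$ and $S_\zeta^k$ on $L_a^2(\mathbb{D},dA)$ commute if and only if $\phi$ and $\zeta$ are linearly dependent.
   Context: $\mathbb{D}=\{z\in\mathbb{C}:|z|<1\}$ and $dA$ is Lebesgue area measure on $\mathbb{D}$ normalized so that $\mathbb{D}$ has measure $1$. $L^2(\mathbb{D},dA)$ has inner product $\langle f,g\rangle=\int_{\mathbb{D}} f\overline{g}\,dA$, and the Bergman space $L_a^2(\mathbb{D},dA)$ is the closed subspace of analytic functions in $L^2(\mathbb{D},dA)$; $\{\sqrt{n+1}\,z^n\}_{n\ge 0}$ is an orthonormal basis of it. $P: L^2(\mathbb{D},dA)\to L_a^2(\mathbb{D},dA)$ is the orthogonal projection. $J:L^2(\mathbb{D},dA)\to L^2(\mathbb{D},dA)$ is given by $(Jf)(z)=f(\bar z)$, and $M_\phi f=\phi f$. For $\phi\in L^\infty(\mathbb{D},dA)$ the little Hankel operator $H_\phi$ on $L_a^2(\mathbb{D},dA)$ is $H_\phi f = PJM_\phi f$. For an integer $k\ge 2$, $W_k$ is the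 bounded linear operator on $L_a^2(\mathbb{D},dA)$ determined by $W_k(z^{kn})=z^n$ and $W_k(z^{kn+p})=0$ for all integers $n\ge 0$ and $p=1,\dots,k-1$. The $k$th-order slant little Hankel operator with symbol $\phi$ is the bounded operator $S_\phi^k = W_kH_\phi$ on $L_a^2(\mathbb{D},dA)$. *)

(* Defs.v *)
From HB Require Import structures.
From mathcomp Require Import all_boot all_order all_algebra.
From mathcomp Require Import complex.
From mathcomp Require Import all_classical all_reals all_analysis.

Set Implicit Arguments.
Unset Strict Implicit.
Unset Printing Implicit Defensive.

Import Order.TTheory GRing.Theory Num.Theory.
Import numFieldNormedType.Exports.

Local Open Scope classical_set_scope.
Local Open Scope ring_scope.
Local Open Scope complex_scope.

Section BergmanSpace.
Variable R : realType.
Local Notation C := R[i].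
Local Notation plane := (measurableTypeR R * measurableTypeR R)%type.

Definition unit_disk : set C := [set z | `|z| < 1].

(* [C] carries no measurable structure in the library, so measures live on
   [plane], identified with [C] through (x, y) |-> x + iy. *)
Definition of_plane (p : plane) : C := p.1 +i* p.2.

Definition plane_disk : set plane := of_plane @^-1` unit_disk.

Definition lebesgue2 : {measure set plane -> \bar R} :=
  (lebesgue_measure \x lebesgue_measure)%E.

Fact inv_area_ge0 : 0 <= (fine (lebesgue2 plane_disk))^-1.
Proof. by rewrite invr_ge0 fine_ge0. Qed.

Definition dA : {measure set plane -> \bar R} :=
  mscale (NngNum inv_area_ge0) lebesgue2.

Definition cmeasurable (f : C -> C) : Prop :=
  measurable_fun plane_disk (fun p => complex.Re (f (of_plane p))) /\
  measurable_fun plane_disk (fun p => complex.Im (f (of_plane p))).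

Definition cintegral (f : C -> C) : C :=
  Rintegral dA plane_disk (fun p => complex.Re (f (of_plane p)))
  +i* Rintegral dA plane_disk (fun p => complex.Im (f (of_plane p))).

(* Elements of function spaces on the disk are represented by total functions
   [C -> C] whose values outside the disk are irrelevant. *)
Definition L2 (f : C -> C) : Prop :=
  cmeasurable f /\
  (\int[dA]_(p in plane_disk) ((ComplexField.Normc.normc (f (of_plane p))) ^+ 2)%:E < +oo)%E.

Definition Linfty (f : C -> C) : Prop :=
  cmeasurable f /\
  exists M : R,
    {ae dA, forall p, plane_disk p -> ComplexField.Normc.normc (f (of_plane p)) <= M}.

Definition inner (f g : C -> C) : C := cintegral (fun z => f z * (g z)^*).

Definition L2norm (f : C -> C) : R := Num.sqrt (complex.Re (inner f f)).

Definition analytic_on (U : set C) (f : C -> C) : Prop :=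
  forall a : C, U a ->
    exists (c : nat -> C) (r : C), 0 < r /\
      forall z : C, `|z - a| < r ->
        (series (fun n => c n * (z - a) ^+ n) : nat -> C^o) @ \oo
          --> (f z : C^o).

Definition bergman (f : C -> C) : Prop := L2 f /\ analytic_on unit_disk f.

Definition is_bergman_proj (g h : C -> C) : Prop :=
  bergman h /\
  forall u, bergman u -> inner (fun z => g z - h z) u = 0.

(* For [g] in L^2 the projection exists and its values on the disk are unique;
   off the disk [xget] makes an arbitrary choice. *)
Definition bergman_proj (g : C -> C) : C -> C :=
  xget (cst 0) [set h | is_bergman_proj g h].

Definition Jop (f : C -> C) : C -> C := fun z => f z^*.

Definition Mop (phi f : C -> C) : C -> C := fun z => phi z * f z.

Definition little_hankel (phi f : C -> C) : C -> C :=
  bergman_proj (Jop (Mop phi f)).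

(* Linearity is stated on the disk, where elements of the space are compared. *)
Definition bounded_operator (T : (C -> C) -> (C -> C)) : Prop :=
  [/\ forall f, bergman f -> bergman (T f),
      forall (c : C) f g, bergman f -> bergman g ->
        {in unit_disk, T (fun z => c * f z + g z)
                       =1 (fun z => c * T f z + T g z)} &
      exists M : R, forall f, bergman f -> L2norm (T f) <= M * L2norm f].

Definition is_slant (k : nat) (W : (C -> C) -> (C -> C)) : Prop :=
  [/\ bounded_operator W,
      forall n : nat,
        {in unit_disk, W (fun z => z ^+ (k * n)) =1 (fun z => z ^+ n)} &
      forall n p : nat, (1 <= p <= k.-1)%N ->
        {in unit_disk, W (fun z => z ^+ (k * n + p)) =1 (fun=> 0)}].

Definition slant_little_hankel (W : (C -> C) -> (C -> C)) (phi f : C -> C) :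
    C -> C := W (little_hankel phi f).

Definition commute_on_bergman (S T : (C -> C) -> (C -> C)) : Prop :=
  forall f, bergman f -> {in unit_disk, S (T f) =1 T (S f)}.

Definition lin_dependent (f g : C -> C) : Prop :=
  exists c d : C, (c, d) <> (0, 0) /\
    forall z, unit_disk z -> c * f z + d * g z = 0.

Definition conj_poly (n : nat) (a : nat -> C) : C -> C :=
  fun z => \sum_(0 <= i < n.+1) a i * z^* ^+ i.

End BergmanSpace.

(* Main.v *)
From HB Require Import structures.
Require Import Defs.
From mathcomp Require Import all_boot all_order all_algebra.
From mathcomp Require Import complex.
From mathcomp Require Import all_classical all_reals all_analysis.
From mathcomp Require Import measurable_realfun.
From mathcomp Require Import ring lra zify.

(** The Bergman projection sends [z^i zbar^q] to [(i-q+1)/(i+1) z^(i-q)], or to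
    zero when [q > i] ([is_bergman_proj_monomial]). Hence the slant little Hankel
    operator with symbol [phi = sum a_i zbar^i] sends [z^q] to
    [sum_j a_(kj+q) (kj+1)/(kj+q+1) z^j] ([slant_little_hankel_monomial]), and
    two commuting operators have commuting matrices. Let [A] and [B] be those of
    [phi] and [zeta].

    That commuting matrices come from dependent symbols
    ([slant_commute_multiple]) is a descent on the degree. If the coefficients
    of [phi] beyond the index [t] vanish, then column [t] of [A] only has its
    top entry [a_t/(t+1)], and the entry [(p2,t)] of [B A] is a nonzero multiple
    of [b_(k p2) a_t]; so [a_t = 0] as soon as the entry [(p2,t)] of [A B]
    vanishes. For [t > m] it does, because column [t] of [B] is zero. This
    brings the degree of [phi] down to [m], and subtracting a multiple of [zeta],
    which preserves commutation, makes [a_m] vanish too. Column [m] of [A] is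
    now zero and that of [B] is reduced to a nonzero top entry, hence column [0]
    of [A] is zero, in particular [a_(k p2) = 0]. Now let [t < m]. The entry
    [(p2,t)] of [A B] is a weighted sum of the products [a_(k p2 + s) b_(ks+t)].
    The term [s = 0] has just been seen to vanish; if [s > 0] and
    [k p2 + s <= t], then [ks + t > k p2 + k > m]; otherwise [k p2 + s > t].
    So every term vanishes and [a_t = 0].

    Conversely, if one symbol is a multiple of the other, so is its operator on
    the whole Bergman space ([slant_commute_of_multiple]). Elements of that
    space matter only through their values on the disk: two projections of the
    same square-integrable function agree there ([is_bergman_proj_unique]), and
    a bounded operator respects equality on the disk ([slant_ext]).

    The projection formula has to be tested against every [u] in the Bergman
    space, and [u] is only known to have a power series around each point.
    Instead of expanding [u] at the origin, one applies Green's formula on the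
    disk of radius [r < 1] to [v u], where [v] is a combination of
    [z^q zbar^(i+1)] and [z^(q-i-1)] or [zbar^(i+1-q)] that vanishes on the
    circle ([integral_closed_disk_monomial]), and lets [r] tend to 1. This needs
    [u] to be continuously differentiable, which follows from the strict
    differentiability of power series at their centers
    ([pseries_strict_diff]). *)

Set Implicit Arguments.
Unset Strict Implicit.
Unset Printing Implicit Defensive.

Import Order.TTheory GRing.Theory Num.Theory.
Import numFieldNormedType.Exports.
Import ComplexField.Normc.

Local Open Scope classical_set_scope.
Local Open Scope ring_scope.
Local Open Scope complex_scope.

(** * The modulus of complex numbers *)

Section ComplexBasics.
Variable R : realType.
Local Notation C := R[i].

Implicit Types (z w : C).

Lemma normrE z : `|z| = (normc z)%:C.
Proof. by case: z. Qed.

Lemma normc_ge0 z : 0 <= normc z.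
Proof. by case: z => x y; exact: sqrtr_ge0. Qed.

Lemma normcD z w : normc (z + w) <= normc z + normc w.
Proof. exact: le_normcD. Qed.

Lemma normcX z n : normc (z ^+ n) = normc z ^+ n.
Proof.
elim: n => [|n IH]; first by rewrite !expr0 normc1.
by rewrite !exprS normcM IH.
Qed.

Lemma normcR (x : R) : 0 <= x -> normc x%:C = x.
Proof. by move=> x0; rewrite /= expr0n addr0 sqrtr_sqr ger0_norm. Qed.

Lemma normc_conj z : normc z^* = normc z.
Proof. by case: z => x y /=; rewrite sqrrN. Qed.

Lemma sqr_normcE z : normc z ^+ 2 = complex.Re z ^+ 2 + complex.Im z ^+ 2.
Proof. by case: z => x y /=; rewrite sqr_sqrtr// addr_ge0// sqr_ge0. Qed.

Lemma Re_le_normc z : `|complex.Re z| <= normc z.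
Proof.
by rewrite -lecR -normrE; exact: normc_ge_Re.
Qed.

Lemma Im_le_normc z : `|complex.Im z| <= normc z.
Proof.
case: z => x y /=; rewrite -sqrtr_sqr ler_sqrt ?lerDr ?sqr_ge0//.
by rewrite addr_ge0// sqr_ge0.
Qed.

Lemma normc_le_ReIm z : normc z <= `|complex.Re z| + `|complex.Im z|.
Proof.
rewrite -(@ler_pXn2r _ 2) ?nnegrE ?normc_ge0 ?addr_ge0//.
rewrite sqr_normcE sqrrD !real_normK ?num_real//.
by have := mulr_ge0 (normr_ge0 (complex.Re z)) (normr_ge0 (complex.Im z)); lra.
Qed.

Lemma normc_sum I (s : seq I) (F : I -> C) :
  normc (\sum_(i <- s) F i) <= \sum_(i <- s) normc (F i).
Proof.
elim: s => [|i s IH]; first by rewrite !big_nil normc0.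
by rewrite !big_cons (le_trans (normcD _ _))// lerD2l.
Qed.

Lemma cvg_normc (x : nat -> C) (l : C) :
  (x : nat -> C^o) @ \oo --> (l : C^o) ->
  forall e : R, 0 < e -> \forall n \near \oo, normc (l - x n) < e.
Proof.
move=> /cvgrPdist_lt h e e0; have := h e%:C; rewrite ltcR => /(_ e0).
by apply: filterS => n; rewrite normrE ltcR.
Qed.

Lemma normc_cvg (x : nat -> C) (l : C) :
  (forall e : R, 0 < e -> \forall n \near \oo, normc (l - x n) < e) ->
  (x : nat -> C^o) @ \oo --> (l : C^o).
Proof.
move=> h; apply/cvgrPdist_lt => e.
case: e => t y; rewrite ltcE/= => /andP[/eqP -> t0].
by apply: filterS (h t t0) => n; rewrite normrE ltcR.
Qed.

Lemma cvg_normc_lin (k : C) (x y : nat -> C) (l m : C) :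
  (x : nat -> C^o) @ \oo --> (l : C^o) ->
  (y : nat -> C^o) @ \oo --> (m : C^o) ->
  ((fun n => k * x n + y n) : nat -> C^o) @ \oo --> (k * l + m : C^o).
Proof.
move=> /cvg_normc xl /cvg_normc ym; apply: normc_cvg => e e0.
have k0 : 0 < normc k + 1 by rewrite ltr_wpDl// normc_ge0.
have d0 : 0 < e / 2 / (normc k + 1) by rewrite !divr_gt0.
have e2 : 0 < e / 2 by rewrite divr_gt0.
apply: filterS2 (xl _ d0) (ym _ e2) => n; rewrite ltr_pdivlMr// => xn yn.
have -> : k * l + m - (k * x n + y n) = k * (l - x n) + (m - y n) by ring.
rewrite (le_lt_trans (normcD _ _))// normcM.
have := normc_ge0 (l - x n); lra.
Qed.

Lemma le_lim_normc (x : nat -> C) (l : C) (B : R) :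
  (x : nat -> C^o) @ \oo --> (l : C^o) ->
  (\forall n \near \oo, normc (x n) <= B) -> normc l <= B.
Proof.
move=> /cvg_normc xl xB; apply/ler_addgt0Pr => e e0.
near \oo => n.
rewrite -[l](subrK (x n)) (le_trans (normcD _ _))// addrC lerD//.
  by near: n.
by apply: ltW; near: n; exact: xl.
Unshelve. all: by end_near. Qed.

End ComplexBasics.

(** * Strict differentiability of power series *)

Section StrictDifferentiability.
Variable R : realType.
Local Notation C := R[i].
Local Notation normc := (@normc R).

Lemma normc_subrXX (s : R) (z w : C) n : normc z <= s -> normc w <= s ->
  normc (z ^+ n.+2 - w ^+ n.+2) <=
  normc (z - w) * (normc z + normc w) * (n.+2%:R * s ^+ n).
Proof.
move=> zs ws; have z0 := normc_ge0 z; have w0 := normc_ge0 w.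
have s0 : 0 <= s := le_trans z0 zs.
have d0 := normc_ge0 (z - w).
elim: n => [|n IH].
  rewrite subr_sqr normcM expr0 mulr1 -mulrA ler_wpM2l//.
  by rewrite (le_trans (normcD _ _))// ler_peMr ?addr_ge0// ler1n.
have -> : z ^+ n.+3 - w ^+ n.+3 =
    z * (z ^+ n.+2 - w ^+ n.+2) + (z - w) * (w * w ^+ n.+1).
  by rewrite -exprS mulrBr -exprS mulrBl -exprS [z * _]mulrC; ring.
rewrite (le_trans (normcD _ _))// !normcM normcX.
have wn : normc w ^+ n.+1 <= s ^+ n.+1 by rewrite lerXn2r ?nnegrE.
have le1 : normc z * normc (z ^+ n.+2 - w ^+ n.+2) <=
    s * (normc (z - w) * (normc z + normc w) * (n.+2%:R * s ^+ n)).
  by rewrite ler_pM// normc_ge0.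
have le2 : normc (z - w) * (normc w * normc w ^+ n.+1) <=
    normc (z - w) * ((normc z + normc w) * s ^+ n.+1).
  by rewrite ler_wpM2l// ler_pM ?exprn_ge0// lerDr.
rewrite (le_trans (lerD le1 le2))// exprS -[n.+3%:R]natr1 le_eqVlt.
by apply/orP; left; apply/eqP; ring.
Qed.

(** The terms of the series at a point of the disk of convergence are bounded,
    so closer to the center they are dominated by a geometric sequence. *)
Lemma pseries_coef_bound (c : nat -> C) (a : C) (t : R) (u : C -> C) : 0 < t ->
  (forall z, normc (z - a) < t ->
     (series (fun n => c n * (z - a) ^+ n) : nat -> C^o) @ \oo
       --> (u z : C^o)) ->
  exists M : R, 0 <= M /\ forall n, normc (c n) * (t / 2) ^+ n <= M.
Proof.
move=> t0 h; pose x n := c n * ((t / 2)%:C) ^+ n.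
have t2 : 0 <= t / 2 by lra.
have xE n : normc (x n) = normc (c n) * (t / 2) ^+ n.
  by rewrite normcM normcX normcR.
have : (x : nat -> C^o) @ \oo --> (0 : C^o).
  apply: (@cvg_series_cvg_0 _ (C^o)); apply/cvg_ex; exists (u (a + (t / 2)%:C)).
  have := h (a + (t / 2)%:C); rewrite addrAC subrr add0r normcR//.
  by apply; lra.
move=> /cvg_normc /(_ 1 ltr01)[N _ xN].
exists (\sum_(i < N) normc (x i) + 1); split.
  by rewrite addr_ge0// sumr_ge0// => i _; exact: normc_ge0.
move=> n; rewrite -xE; have [nN|Nn] := ltnP n N.
  rewrite (bigD1 (Ordinal nN))//= -addrA lerDl addr_ge0// sumr_ge0// => i _.
  exact: normc_ge0.
apply: (@le_trans _ _ 1).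
  by apply/ltW; have := xN n Nn; rewrite sub0r normcN.
by rewrite lerDr sumr_ge0// => i _; exact: normc_ge0.
Qed.

Lemma natS2_le_exp2 j : ((j.+2)%:R : R) <= 2 * 2 ^+ j.
Proof.
elim: j => [|j IH]; first by rewrite expr0 mulr1.
rewrite -[_.+3%:R]natr1 exprS.
have : (1 : R) <= 2 ^+ j by rewrite exprn_ege1// ler1n.
lra.
Qed.

Lemma sum_geo_half n : \sum_(0 <= j < n) ((1 : R) / 2) ^+ j <= 2.
Proof.
suff -> : \sum_(0 <= j < n) ((1 : R) / 2) ^+ j = 2 - 2 * (1 / 2) ^+ n.
  by rewrite gerBl mulr_ge0// exprn_ge0// divr_ge0.
elim: n => [|n IH]; first by rewrite big_geq// expr0; lra.
by rewrite big_nat_recr//= IH exprS; lra.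
Qed.

(** Strict differentiability, at the center of a power series: unlike plain
    differentiability it controls both endpoints, which is what makes the
    derivative continuous without differentiating the series termwise. *)
Lemma pseries_strict_diff (c : nat -> C) (a : C) (t : R) (u : C -> C) : 0 < t ->
  (forall z, normc (z - a) < t ->
     (series (fun n => c n * (z - a) ^+ n) : nat -> C^o) @ \oo
       --> (u z : C^o)) ->
  exists K d : R, [/\ 0 <= K, 0 < d & forall z w,
    normc (z - a) < d -> normc (w - a) < d ->
    normc (u z - u w - c 1%N * (z - w)) <=
      K * normc (z - w) * (normc (z - a) + normc (w - a))].
Proof.
move=> t0 h; have [M [M0 cM]] := pseries_coef_bound t0 h.
(* a quarter of the radius at which the coefficients are controlled *)
pose s := t / 8; have s0 : 0 < s by rewrite /s; lra.
exists (M / (4 * s ^+ 2)), s; split => //.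
  by rewrite divr_ge0// mulr_ge0// exprn_ge0// ltW.
move=> z w zs ws; set Z := z - a; set W := w - a.
have ZW : z - w = Z - W by rewrite /Z /W; ring.
pose y n := (c n * Z ^+ n) : C^o.
pose x N := (series (fun n => c n * Z ^+ n) N
            - series (fun n => c n * W ^+ n) N - c 1%N * (z - w)) : C^o.
have : x @ \oo --> ((u z - u w - c 1%N * (z - w)) : C^o).
  apply: (@cvgB _ C^o); last exact: cvg_cst.
  apply: (@cvgB _ C^o); apply: h.
    by rewrite (lt_trans zs)// /s; lra.
  by rewrite (lt_trans ws)// /s; lra.
move=> /le_lim_normc; apply; exists 2%N => // N /= N2.
have [n ->] : exists n, N = n.+2 by exists N.-2; lia.
have -> : x n.+2 = \sum_(0 <= j < n) c j.+2 * (Z ^+ j.+2 - W ^+ j.+2).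
  rewrite /x /series/= !big_nat_recl// !expr0 !mulr1 !expr1 ZW.
  under [in RHS]eq_bigr do rewrite mulrBr.
  by rewrite sumrB; ring.
rewrite (le_trans (normc_sum _ _))//.
pose D := normc (Z - W) * (normc Z + normc W).
have D0 : 0 <= D by rewrite mulr_ge0 ?addr_ge0 ?normc_ge0.
apply: (@le_trans _ _ (\sum_(0 <= j < n) M / (8 * s ^+ 2) * D * (1 / 2) ^+ j)).
  apply: ler_sum => j _; rewrite normcM.
  have cj := cM j.+2.
  have st : t / 2 = 4 * s by rewrite /s; lra.
  have {}cj : normc (c j.+2) <= M / (4 * s) ^+ j.+2.
    by rewrite ler_pdivlMr ?exprn_gt0 ?mulr_gt0// -st.
  have := normc_subrXX j (ltW zs) (ltW ws); rewrite -/Z -/W -/D => le1.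
  rewrite (le_trans (ler_pM (normc_ge0 _) (normc_ge0 _) cj le1))//.
  pose q := (1 / 2 : R) ^+ j.
  have q2 : 2 ^+ j * q = 1 by rewrite -exprMn div1r mulfV// expr1n.
  have q4 : s ^+ j / (4 * s) ^+ j = q * q.
    rewrite -expr_div_n -exprMn; congr (_ ^+ _).
    by field; rewrite gt_eqF.
  have -> : M / (4 * s) ^+ j.+2 * (D * (j.+2%:R * s ^+ j)) =
     M / (16 * s ^+ 2) * D * (j.+2%:R * (q * q)).
    rewrite -q4 [(4 * s) ^+ j.+2]exprS [(4 * s) ^+ j.+1]exprS; field.
    by rewrite expf_neq0 ?mulf_neq0 ?gt_eqF.
  rewrite -/q; have -> : M / (8 * s ^+ 2) * D * q =
     M / (16 * s ^+ 2) * D * ((2 * 2 ^+ j) * (q * q)).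
    have -> : 2 * 2 ^+ j * (q * q) = 2 * q.
      by rewrite mulrA -[2 * _ * q]mulrA q2 mulr1.
    field.
    by rewrite gt_eqF.
  have q0 : 0 <= q * q by rewrite mulr_ge0// exprn_ge0//; lra.
  apply: ler_wpM2l; last exact: ler_wpM2r (natS2_le_exp2 j).
  by rewrite mulr_ge0// divr_ge0// mulr_ge0// exprn_ge0// ltW.
have -> : M / (4 * s ^+ 2) * normc (z - w) * (normc Z + normc W) =
    M / (8 * s ^+ 2) * D * 2.
  by rewrite ZW /D; field; rewrite gt_eqF.
rewrite -mulr_sumr.
rewrite ler_wpM2l ?sum_geo_half// mulr_ge0// divr_ge0// mulr_ge0//.
by rewrite exprn_ge0// ltW.
Qed.

End StrictDifferentiability.

(** * Continuously differentiable functions on the disk *)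

Section SmoothComplexFunctions.
Variable R : realType.
Local Notation C := R[i].
Local Notation normc := (@normc R).
Local Notation Re := (@complex.Re R).
Local Notation Im := (@complex.Im R).
Implicit Types (f g F G : C -> C) (z w a : C).

(** Strict differentiability at [a] with derivative [l], with an explicit
    remainder: the little-o in the usual definition is replaced by a multiple
    of the distances to [a], as power series provide it. *)
Definition strict_diff (u : C -> C) (a l : C) : Prop :=
  exists K d : R, [/\ 0 <= K, 0 < d & forall z w,
    normc (z - a) < d -> normc (w - a) < d ->
    normc (u z - u w - l * (z - w)) <=
      K * normc (z - w) * (normc (z - a) + normc (w - a))].

Lemma unit_diskE z : unit_disk z <-> normc z < 1.
Proof. by rewrite /unit_disk/= normrE -ltcR. Qed.

Lemma analytic_strict_diff (u : C -> C) : analytic_on (@unit_disk R) u ->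
  exists du : C -> C, forall a, normc a < 1 -> strict_diff u a (du a).
Proof.
move=> an.
suff /choice[du H] : forall a, exists l, normc a < 1 -> strict_diff u a l.
  by exists du.
move=> a; have [a1|_] := boolP (normc a < 1); last by exists 0.
have /an[c [r [r0 cu]]] : unit_disk a by apply/unit_diskE.
exists (c 1%N) => _; case: r r0 cu => t y; rewrite ltcE/= => /andP[/eqP -> t0] cu.
apply: (@pseries_strict_diff _ _ _ t) => // z za; apply: cu.
by rewrite normrE ltcR.
Qed.

(** The expansions of [u (b + h) - u b] around [a] and around [b] differ by
    [(du b - du a) * h]; letting [h] tend to 0 bounds [du b - du a]. *)
Lemma strict_diff_deriv_continuous (u du : C -> C) a :
  (forall b, normc b < 1 -> strict_diff u b (du b)) -> normc a < 1 ->
  exists K d : R, [/\ 0 <= K, 0 < d &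
    forall b, normc (b - a) < d -> normc (du b - du a) <= K * normc (b - a)].
Proof.
move=> udu a1; have [K [d [K0 d0 H]]] := udu a a1.
exists (2 * K), (Num.min d (1 - normc a)); split; first by rewrite mulr_ge0.
  by rewrite lt_min d0 subr_gt0.
move=> b; rewrite lt_min => /andP[bd ba].
have b1 : normc b < 1.
  by rewrite -[b](subrK a) (le_lt_trans (normcD _ _))// -ltrBrDr.
have [K' [d' [K'0 d'0 H']]] := udu b b1.
apply/ler_addgt0Pr => e e0.
(* both expansions apply to [h], and [(K + K') * h] is below [e] *)
pose h := Num.min (Num.min (d - normc (b - a)) d') (e / (K + K' + 1)) / 2.
have m0 : 0 < Num.min (Num.min (d - normc (b - a)) d') (e / (K + K' + 1)).
  by rewrite !lt_min subr_gt0 bd d'0 divr_gt0//; lra.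
have h0 : 0 < h by rewrite /h divr_gt0.
have /andP[/andP[h1 h2] h3] : [&& (h < d - normc (b - a)) && (h < d')
    & h < e / (K + K' + 1)].
  by rewrite -!lt_min /h; lra.
have nh : normc h%:C = h by rewrite normcR// ltW.
have bh : normc (b + h%:C - a) <= normc (b - a) + h.
  have -> : b + h%:C - a = (b - a) + h%:C by ring.
  by rewrite (le_trans (normcD _ _))// nh.
have bhb : b + h%:C - b = h%:C by ring.
have := H (b + h%:C) b; rewrite bhb nh => /(_ _ bd) P1.
have {}P1 := P1 (le_lt_trans bh _); rewrite -ltrBrDl in P1; have {}P1 := P1 h1.
have := H' (b + h%:C) b; rewrite bhb nh subrr normc0 addr0 => P2.
have {}P2 := P2 h2 d'0.
have E : (du b - du a) * h%:C = (u (b + h%:C) - u b - du a * h%:C)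
   - (u (b + h%:C) - u b - du b * h%:C) by ring.
have : normc (du b - du a) * h <= (2 * K * normc (b - a) + (K + K') * h) * h.
  rewrite -{1}nh -normcM E (le_trans (normcD _ _))// normcN.
  rewrite (le_trans (lerD P1 P2))// -subr_ge0.
  have -> : (2 * K * normc (b - a) + (K + K') * h) * h -
    (K * h * (normc (b + h%:C - a) + normc (b - a)) + K' * h * h) =
    K * h * (normc (b - a) + h - normc (b + h%:C - a)) by ring.
  by rewrite !mulr_ge0 ?subr_ge0// ltW.
rewrite ler_pM2r// => /le_trans; apply; rewrite lerD2l.
have KK : 0 < K + K' + 1 by lra.
move: h3; rewrite ltr_pdivlMr// => h3.
by apply: (@le_trans _ _ (h * (K + K' + 1))); lra.
Qed.

(** Continuity is asked of the real and imaginary parts on the real plane,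
    where the measures, the compactness arguments and Fubini's theorem live. *)
Definition ccont (f : C -> C) (z : C) : Prop :=
  {for (Re z, Im z), continuous (fun p : R * R => Re (f (p.1 +i* p.2)))} /\
  {for (Re z, Im z), continuous (fun p : R * R => Im (f (p.1 +i* p.2)))}.

Lemma ccont_normc f a :
  (forall e : R, 0 < e -> exists d : R, 0 < d /\
     forall z, normc (z - a) < d -> normc (f z - f a) <= e) ->
  ccont f a.
Proof.
move=> h.
have near_a e : 0 < e -> \forall p \near nbhs (Re a, Im a),
    normc (f (p.1 +i* p.2) - f a) <= e.
  move=> /h[d [d0 fd]]; apply/nbhs_ballP.
  exists (d / 2) => /=; first by rewrite divr_gt0.
  move=> [x y] [/= bx by_]; apply: fd.
  rewrite (le_lt_trans (normc_le_ReIm _))//.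
  move: bx by_; rewrite /ball/= => bx by_.
  by case: a {h} bx by_ => u v /= bx by_; rewrite distrC [`|y - v|]distrC; lra.
split; apply/cvgrPdist_le => /= e /near_a; apply: filterS => p /=.
  move=> /(le_trans (Re_le_normc _)); rewrite distrC.
  by rewrite (_ : Re (f _ - f _) = Re (f (p.1 +i* p.2)) - Re (f (Re a +i* Im a)))//; case: (a) => ? ? /=; case: (f _) => ? ?; case: (f _).
move=> /(le_trans (Im_le_normc _)); rewrite distrC.
by rewrite (_ : Im (f _ - f _) = Im (f (p.1 +i* p.2)) - Im (f (Re a +i* Im a)))//; case: (a) => ? ? /=; case: (f _) => ? ?; case: (f _).
Qed.

Definition hasD (f : R -> C) (t : R) (l : C) : Prop :=
  is_derive t 1 (fun s => Re (f s)) (Re l) /\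
  is_derive t 1 (fun s => Im (f s)) (Im l).

Lemma ReD z w : Re (z + w) = Re z + Re w. Proof. by case: z; case: w. Qed.
Lemma ImD z w : Im (z + w) = Im z + Im w. Proof. by case: z; case: w. Qed.
Lemma ReN z : Re (- z) = - Re z. Proof. by case: z. Qed.
Lemma ImN z : Im (- z) = - Im z. Proof. by case: z. Qed.
Lemma ReM z w : Re (z * w) = Re z * Re w - Im z * Im w.
Proof. by case: z; case: w. Qed.
Lemma ImM z w : Im (z * w) = Re z * Im w + Im z * Re w.
Proof. by case: z => a b; case: w => c d /=; ring. Qed.

Lemma is_derive_quadratic (f : R -> R) (t l K d : R) : 0 < d -> 0 <= K ->
  (forall h, `|h| < d -> `|f (t + h) - f t - l * h| <= K * h ^+ 2) ->
  is_derive t 1 f l.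
Proof.
move=> d0 K0 H.
have : (fun h => h^-1 *: (f (h *: 1 + t) - f t)) @ 0^' --> l.
  apply/cvgrPdist_le => /= e e0; near=> h.
  have h0 : h != 0 by near: h; exact: nbhs_dnbhs_neq.
  have -> : l - h^-1 *: (f (h *: 1 + t) - f t) =
      - (h^-1 * (f (t + h) - f t - l * h)).
    by rewrite scaler1 addrC /GRing.scale/= [h + t]addrC; field.
  rewrite normrN normrM normfV ler_pdivrMl ?normr_gt0//.
  have hd : `|h| < d.
    by near: h; apply: dnbhs0_lt.
  rewrite (le_trans (H h hd))// -real_normK ?num_real// expr2 mulrCA ler_wpM2l//.
  have : `|h| <= e / (K + 1) by near: h; apply: dnbhs0_le; rewrite divr_gt0//; lra.
  rewrite ler_pdivlMr; last by lra.
  by move=> ?; have := normr_ge0 h; lra.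
move=> hl; apply: DeriveDef; first by apply/cvg_ex; exists l.
by apply/cvg_lim.
Unshelve. all: by end_near. Qed.

(** [Fx] and [Fy] are the partial derivatives in the real coordinates of the
    complex-valued function [F]. *)
Definition C1_at (F Fx Fy : C -> C) (z : C) : Prop :=
  [/\ ccont F z, ccont Fx z, ccont Fy z,
    hasD (fun s => F (s +i* Im z)) (Re z) (Fx z) &
    hasD (fun s => F (Re z +i* s)) (Im z) (Fy z)].

End SmoothComplexFunctions.

Section SmoothRules.
Variable R : realType.
Local Notation C := R[i].
Local Notation normc := (@normc R).
Local Notation Re := (@complex.Re R).
Local Notation Im := (@complex.Im R).
Implicit Types (f g F G : C -> C) (z w a : C).

Lemma ccontD f g z : ccont f z -> ccont g z -> ccont (fun w => f w + g w) z.
Proof.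
move=> [f1 f2] [g1 g2]; split.
  rewrite (_ : (fun _ => _) = (fun p : R * R =>
    Re (f (p.1 +i* p.2)) + Re (g (p.1 +i* p.2)))); first exact: continuousD.
  by apply/funext => p; rewrite ReD.
rewrite (_ : (fun _ => _) = (fun p : R * R =>
  Im (f (p.1 +i* p.2)) + Im (g (p.1 +i* p.2)))); first exact: continuousD.
by apply/funext => p; rewrite ImD.
Qed.

Lemma ccontM f g z : ccont f z -> ccont g z -> ccont (fun w => f w * g w) z.
Proof.
move=> [f1 f2] [g1 g2]; split.
  rewrite (_ : (fun _ => _) = (fun p : R * R =>
    Re (f (p.1 +i* p.2)) * Re (g (p.1 +i* p.2)) -
    Im (f (p.1 +i* p.2)) * Im (g (p.1 +i* p.2)))).
    by apply: continuousB; exact: continuousM.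
  by apply/funext => p; rewrite ReM.
rewrite (_ : (fun _ => _) = (fun p : R * R =>
  Re (f (p.1 +i* p.2)) * Im (g (p.1 +i* p.2)) +
  Im (f (p.1 +i* p.2)) * Re (g (p.1 +i* p.2)))).
  by apply: continuousD; exact: continuousM.
by apply/funext => p; rewrite ImM.
Qed.

Lemma ccont_cst a z : ccont (fun=> a) z.
Proof. by split; exact: cst_continuous. Qed.

Lemma ccont_id z : ccont id z.
Proof. by split; [exact: cvg_fst|exact: cvg_snd]. Qed.

Lemma ccont_conj z : ccont (fun w => w^*) z.
Proof. by split; [exact: cvg_fst|apply: continuousN; exact: cvg_snd]. Qed.

Lemma ccontX f n z : ccont f z -> ccont (fun w => f w ^+ n) z.
Proof.
move=> fz; elim: n => [|n IH].
  rewrite (_ : (fun _ => _) = fun=> 1); first exact: ccont_cst.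
  by apply/funext => w; rewrite expr0.
rewrite (_ : (fun _ => _) = fun w => f w * f w ^+ n); first exact: ccontM.
by apply/funext => w; rewrite exprS.
Qed.

Lemma hasDD (f g : R -> C) t l m : hasD f t l -> hasD g t m ->
  hasD (fun s => f s + g s) t (l + m).
Proof.
move=> [f1 f2] [g1 g2]; split.
  rewrite (_ : (fun _ => _) = (fun s => Re (f s)) + (fun s => Re (g s))).
    by rewrite ReD; exact: is_deriveD.
  by apply/funext => s; rewrite ReD.
rewrite (_ : (fun _ => _) = (fun s => Im (f s)) + (fun s => Im (g s))).
  by rewrite ImD; exact: is_deriveD.
by apply/funext => s; rewrite ImD.
Qed.

Lemma hasDM (f g : R -> C) t l m : hasD f t l -> hasD g t m ->
  hasD (fun s => f s * g s) t (l * g t + f t * m).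
Proof.
move=> [f1 f2] [g1 g2]; split.
  rewrite (_ : (fun _ => _) = (fun s => Re (f s)) * (fun s => Re (g s)) -
    (fun s => Im (f s)) * (fun s => Im (g s))).
    apply: (is_derive_eq (is_deriveB (is_deriveM f1 g1) (is_deriveM f2 g2))).
    by rewrite ReD !ReM /GRing.scale/=; ring.
  by apply/funext => s; rewrite ReM.
rewrite (_ : (fun _ => _) = (fun s => Re (f s)) * (fun s => Im (g s)) +
    (fun s => Im (f s)) * (fun s => Re (g s))).
  apply: (is_derive_eq (is_deriveD (is_deriveM f1 g2) (is_deriveM f2 g1))).
  by rewrite ImD !ImM /GRing.scale/=; ring.
by apply/funext => s; rewrite ImM.
Qed.

Lemma hasD_cst (a : C) t : hasD (fun=> a) t 0.
Proof. by split; exact: is_derive_cst. Qed.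

Lemma C1D F Fx Fy G Gx Gy z : C1_at F Fx Fy z -> C1_at G Gx Gy z ->
  C1_at (fun w => F w + G w) (fun w => Fx w + Gx w) (fun w => Fy w + Gy w) z.
Proof.
move=> [F1 F2 F3 F4 F5] [G1 G2 G3 G4 G5].
by split; [exact: ccontD|exact: ccontD|exact: ccontD|exact: hasDD|exact: hasDD].
Qed.

Lemma C1M F Fx Fy G Gx Gy z : C1_at F Fx Fy z -> C1_at G Gx Gy z ->
  C1_at (fun w => F w * G w) (fun w => Fx w * G w + F w * Gx w)
    (fun w => Fy w * G w + F w * Gy w) z.
Proof.
move=> [F1 F2 F3 F4 F5] [G1 G2 G3 G4 G5]; split; first exact: ccontM.
- by apply: ccontD; exact: ccontM.
- by apply: ccontD; exact: ccontM.
- by have := hasDM F4 G4; case: z {F1 F2 F3 F4 F5 G1 G2 G3 G4 G5}.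
- by have := hasDM F5 G5; case: z {F1 F2 F3 F4 F5 G1 G2 G3 G4 G5}.
Qed.

Lemma C1_cst a z : C1_at (fun=> a) (fun=> 0) (fun=> 0) z.
Proof. by split; try exact: ccont_cst; exact: hasD_cst. Qed.

Lemma C1_id z : C1_at id (fun=> 1) (fun=> 'i%C) z.
Proof.
split; [exact: ccont_id|exact: ccont_cst|exact: ccont_cst|..].
  by split => /=; [exact: is_derive_id|exact: is_derive_cst].
by split => /=; [exact: is_derive_cst|exact: is_derive_id].
Qed.

Lemma C1_conj z : C1_at (fun w => w^*) (fun=> 1) (fun=> - 'i%C) z.
Proof.
split; [exact: ccont_conj|exact: ccont_cst|exact: ccont_cst|..].
  by split => /=; [exact: is_derive_id|exact: is_derive_cst].
split => /=; first by rewrite oppr0; exact: is_derive_cst.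
by apply: is_deriveN; exact: is_derive_id.
Qed.

Lemma C1X F (l m : C) n z : C1_at F (fun=> l) (fun=> m) z ->
  C1_at (fun w => F w ^+ n) (fun w => n%:R * F w ^+ n.-1 * l)
    (fun w => n%:R * F w ^+ n.-1 * m) z.
Proof.
move=> Fz; elim: n => [|n IH].
  have -> : (fun w => F w ^+ 0) = fun=> 1 by apply/funext => w; rewrite expr0.
  have E k : (fun w => 0%:R * F w ^+ 0.-1 * k) = fun=> 0.
    by apply/funext => w; rewrite !mul0r.
  by rewrite !E; exact: C1_cst.
have := C1M Fz IH.
have E k : (fun w => k * F w ^+ n + F w * (n%:R * F w ^+ n.-1 * k)) =
    (fun w => n.+1%:R * F w ^+ n.+1.-1 * k).
  apply/funext => w; case: n {IH} => [|n]; first by rewrite expr0 /=; ring.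
  by rewrite /= exprS -[n.+2%:R]natr1; ring.
rewrite !E (_ : (fun w => F w * F w ^+ n) = fun w => F w ^+ n.+1)//.
by apply/funext => w; rewrite exprS.
Qed.

(** The Cauchy-Riemann equations: an increment [h] of the second coordinate
    is the complex increment [i * h]. *)
Lemma C1_analytic (u du : C -> C) :
  (forall a, normc a < 1 -> strict_diff u a (du a)) ->
  forall a, normc a < 1 -> C1_at u du (fun w => 'i%C * du w) a.
Proof.
move=> udu a a1; have [K [d [K0 d0 H]]] := udu a a1.
have [K' [d' [K'0 d'0 H']]] := strict_diff_deriv_continuous udu a1.
have cdu : ccont du a.
  apply: ccont_normc => e e0; exists (Num.min d' (e / (K' + 1))); split.
    by rewrite lt_min d'0 divr_gt0//; lra.
  move=> z; rewrite lt_min => /andP[zd ze]; rewrite (le_trans (H' _ zd))//.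
  have := normc_ge0 (z - a); move: ze; rewrite ltr_pdivlMr; last by lra.
  lra.
have aE : a = Re a +i* Im a by case: (a).
have Ha z : normc (z - a) < d -> normc (u z - u a - du a * (z - a)) <=
    K * normc (z - a) ^+ 2.
  by move=> zd; have := H z a zd; rewrite subrr normc0 addr0 => /(_ d0); lra.
split; [|exact: cdu|..].
- apply: ccont_normc => e e0.
  pose L := K * d + normc (du a) + 1.
  have L0 : 0 < L by rewrite /L ltr_wpDl// addr_ge0 ?normc_ge0 ?mulr_ge0// ltW.
  exists (Num.min d (e / L)); split; first by rewrite lt_min d0 divr_gt0.
  move=> z; rewrite lt_min => /andP[zd]; rewrite ltr_pdivlMr// => ze.
  have -> : u z - u a = (u z - u a - du a * (z - a)) + du a * (z - a) by ring.
  rewrite (le_trans (normcD _ _))// normcM (le_trans (lerD (Ha z zd) (lexx _)))//.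
  have n0 := normc_ge0 (z - a).
  have : K * normc (z - a) ^+ 2 <= K * d * normc (z - a).
    by rewrite expr2 -mulrA ler_wpM2l// ler_wpM2r// ltW.
  by move: ze; rewrite /L; lra.
- by apply: ccontM => //; exact: ccont_cst.
- have Hh h : `|h| < d -> normc (u ((Re a + h) +i* Im a) - u a - du a * h%:C)
      <= K * h ^+ 2.
    move=> hd; have := Ha ((Re a + h) +i* Im a).
    have -> : ((Re a + h) +i* Im a) - a = h%:C.
      by case: (a) => x y /=; apply/eqP; rewrite eq_complex/= subrr eqxx andbT addrAC subrr add0r.
    rewrite /= expr0n addr0 sqrtr_sqr real_normK ?num_real//.
    by move=> /(_ hd).
  split; apply: (is_derive_quadratic d0 K0) => h hd.
    apply: le_trans (Hh h hd); apply: le_trans (Re_le_normc _).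
    by rewrite !ReD !ReN ReM/= mulr0 subr0 -aE.
  apply: le_trans (Hh h hd); apply: le_trans (Im_le_normc _).
  by rewrite !ImD !ImN ImM/= mulr0 add0r -aE.
- have Hh h : `|h| < d -> normc (u (Re a +i* (Im a + h)) - u a - du a * (0 +i* h))
      <= K * h ^+ 2.
    move=> hd; have := Ha (Re a +i* (Im a + h)).
    have -> : (Re a +i* (Im a + h)) - a = 0 +i* h.
      by case: (a) => x y /=; apply/eqP; rewrite eq_complex/= subrr eqxx/= addrAC subrr add0r.
    rewrite /= expr0n add0r sqrtr_sqr real_normK ?num_real//.
    by move=> /(_ hd).
  split; apply: (is_derive_quadratic d0 K0) => h hd.
    apply: le_trans (Hh h hd); apply: le_trans (Re_le_normc _).
    by rewrite le_eqVlt -aE !ReD !ReN !ReM/=; apply/orP; left; apply/eqP; congr `|_|; ring.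
  apply: le_trans (Hh h hd); apply: le_trans (Im_le_normc _).
  by rewrite le_eqVlt -aE !ImD !ImN !ImM/=; apply/orP; left; apply/eqP; congr `|_|; ring.
Qed.

End SmoothRules.

(** * Measurability and integrability on the plane *)

Section PlaneMeasure.
Variable R : realType.
Local Notation plane := (measurableTypeR R * measurableTypeR R)%type.

(** The product sigma-algebra is generated by measurable rectangles, and an
    open set is a countable union of rectangles with rational vertices. *)
Lemma open_plane_measurable (U : set (R * R)) :
  open U -> measurable (U : set plane).
Proof.
move=> oU.
pose I q : set R := `]ratr q.1, ratr q.2[%classic.
pose F (q : (rat * rat) * (rat * rat)) : set plane :=
  if asbool (I q.1 `*` I q.2 `<=` U) then I q.1 `*` I q.2 else set0.
have -> : (U : set plane) = \bigcup_q F q.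
  apply/seteqP; split => [p /=|p [q _]]; last first.
    by rewrite /F; case: asboolP => // + Iq; exact.
  rewrite openE in oU; move=> /oU/nbhs_ballP[e /= e0 peU].
  have Q (x : R) : exists q : rat * rat, (x \in `](ratr q.1), (ratr q.2)[) /\
      [set` `](ratr q.1), (ratr q.2)[] `<=` ball x e.
    have [q1 q1P] := @rat_in_itvoo R (x - e) x ltac:(lra).
    have [q2 q2P] := @rat_in_itvoo R x (x + e) ltac:(lra).
    exists (q1, q2); split.
      by move: q1P q2P; rewrite !in_itv/= => /andP[_ ->] /andP[->].
    move=> y /=; rewrite /ball/= !in_itv/= => /andP[y1 y2].
    by move: q1P q2P; rewrite !in_itv/= ltr_norml => /andP[? ?] /andP[? ?]; lra.
  have [q1 [p1 h1]] := Q p.1; have [q2 [p2 h2]] := Q p.2.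
  exists (q1, q2) => //; rewrite /F asboolT.
    by split.
  by move=> r [/h1 r1 /h2 r2]; apply: peU; split.
apply: countable_bigcupT_measurable => // q; rewrite /F.
by case: asboolP => // _; apply: measurableX; exact: measurable_itv.
Qed.

(** Continuity at the points of [A] is that of functions on the whole plane,
    so on [A] the preimage of an open set coincides with its interior. *)
Lemma measurable_fun_continuous_at (A : set plane) (f : R * R -> R) :
  measurable A -> (forall p, A p -> {for p, continuous f}) ->
  measurable_fun A f.
Proof.
move=> mA cf _; apply: (measurability _ (measurable_realfun.RGenOpens.measurableE R)) => //.
move=> _ [_ [a [b ->] <-]].
pose V : set (R * R) := (f @^-1` `]a, b[%classic)^°.
rewrite (_ : A `&` _ = A `&` (V : set plane)).
  by apply: measurableI => //; apply: open_plane_measurable; exact: open_interior.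
apply/seteqP; split => p [Ap pV]; split => //.
  have fp : f @ p --> f p := cf p Ap.
  have : nbhs (f p) `]a, b[%classic.
    by apply: open_nbhs_nbhs; split => //; exact: interval_open.
  exact: fp.
exact: (@interior_subset _ _ _ pV).
Qed.

Definition closed_disk (r : R) : set plane :=
  [set p | (p.1 : R) ^+ 2 + (p.2 : R) ^+ 2 <= r ^+ 2].

Lemma continuous_sqr_sum : continuous (fun p : R * R => p.1 ^+ 2 + p.2 ^+ 2).
Proof.
move=> p; apply: (@continuousD _ _ _ (fun p : R * R => p.1 ^+ 2)
   (fun p : R * R => p.2 ^+ 2)).
  apply: (@continuous_comp _ _ _ (fun p : R * R => p.1) (fun x : R => x ^+ 2)).
    exact: cvg_fst.
  exact: exprn_continuous.
apply: (@continuous_comp _ _ _ (fun p : R * R => p.2) (fun x : R => x ^+ 2)).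
  exact: cvg_snd.
exact: exprn_continuous.
Qed.

Lemma measurable_sqr_sum :
  measurable_fun setT (fun p : plane => (p.1 : R) ^+ 2 + (p.2 : R) ^+ 2).
Proof.
apply: measurable_fun_continuous_at => // p _; exact: continuous_sqr_sum.
Qed.

Lemma measurable_closed_disk r : measurable (closed_disk r).
Proof.
rewrite (_ : closed_disk r = setT `&` (fun p : plane => (p.1 : R) ^+ 2 +
  (p.2 : R) ^+ 2) @^-1` `]-oo, r ^+ 2]%classic).
  by apply: measurable_sqr_sum => //; exact: measurable_itv.
by rewrite setTI; apply/seteqP; split => p /=; rewrite in_itv.
Qed.

Lemma plane_diskE (p : plane) :
  @plane_disk R p <-> (p.1 : R) ^+ 2 + (p.2 : R) ^+ 2 < 1.
Proof.
split => [/unit_diskE/= p1|p1].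
  rewrite -[ltRHS](expr1n _ 2).
  by rewrite -(@sqr_sqrtr _ (_ + _)) ?addr_ge0 ?sqr_ge0// ltrXn2r// nnegrE.
by apply/unit_diskE => /=; rewrite -sqrtr1 ltr_sqrt.
Qed.

Lemma measurable_plane_disk : measurable (@plane_disk R).
Proof.
rewrite (_ : @plane_disk R = setT `&` (fun p : plane => (p.1 : R) ^+ 2 +
  (p.2 : R) ^+ 2) @^-1` `]-oo, 1[%classic).
  by apply: measurable_sqr_sum => //; exact: measurable_itv.
by rewrite setTI; apply/seteqP; split => p; rewrite /= in_itv/= => /plane_diskE.
Qed.

Lemma compact_closed_disk r : 0 <= r -> compact (closed_disk r : set (R * R)).
Proof.
move=> r0; apply: (@subclosed_compact _ _ (`[-r, r]%classic `*` `[-r, r]%classic)).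
- rewrite (_ : (closed_disk r : set (R * R)) = (fun p : R * R => p.1 ^+ 2 +
    p.2 ^+ 2) @^-1` `]-oo, r ^+ 2]%classic).
    apply: closed_comp; first by move=> p _; exact: continuous_sqr_sum.
    exact: interval_closed.
  by apply/seteqP; split => p /=; rewrite in_itv.
- by apply: compact_setX; exact: segment_compact.
- move=> [x y] /=; rewrite /closed_disk/= !in_itv/= => xy.
  have x2 := sqr_ge0 x; have y2 := sqr_ge0 y.
  by split; rewrite -ler_norml -(@ler_pXn2r _ 2) ?nnegrE// real_normK ?num_real//; lra.
Qed.

Lemma lebesgue2_closed_disk r : (lebesgue2 R (closed_disk r) < +oo)%E.
Proof.
have s0 := normr_ge0 r; have s2 : `|r| ^+ 2 = r ^+ 2 by rewrite real_normK ?num_real.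
move: `|r| s0 s2 => s s0 s2.
have : closed_disk r `<=` (`[-s, s]%classic `*` `[-s, s]%classic : set plane).
  move=> [x y] /=; rewrite /closed_disk/= !in_itv/= => xy.
  have x2 := sqr_ge0 x; have y2 := sqr_ge0 y.
  by split; rewrite -ler_norml -(@ler_pXn2r _ 2) ?nnegrE// real_normK ?num_real//; lra.
move=> /(le_measure (lebesgue2 R)) -/(_ _ _)/le_lt_trans; apply.
- by rewrite inE; exact: measurable_closed_disk.
- by rewrite inE; apply: measurableX; exact: measurable_itv.
rewrite /lebesgue2/= product_measure1E ?measurable_itv//=.
by rewrite !lebesgue_measure_itv/=; case: ifP => _; rewrite ?mule0 ?ltry// -EFinM ltry.
Qed.

Lemma continuous_closed_disk_integrable r (f : R * R -> R) : 0 <= r ->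
  (forall p, closed_disk r p -> {for p, continuous f}) ->
  (lebesgue2 R).-integrable (closed_disk r) (EFin \o f).
Proof.
move=> r0 cf; apply: measurable_bounded_integrable.
- exact: measurable_closed_disk.
- exact: lebesgue2_closed_disk.
- by apply: measurable_fun_continuous_at => //; exact: measurable_closed_disk.
- have : compact (f @` (closed_disk r : set (R * R))).
    apply: continuous_compact; last exact: compact_closed_disk.
    apply: continuous_in_subspaceT => p /set_mem; exact: cf.
  move=> /compact_bounded[M [Mr MB]]; exists M; split => // x Mx p /= pr.
  by apply: MB Mx _ _; exists p.
Qed.

End PlaneMeasure.

(** * Green's formula on a disk *)

Section Green.
Variable R : realType.
Local Notation C := R[i].
Local Notation normc := (@normc R).
Local Notation Re := (@complex.Re R).
Local Notation Im := (@complex.Im R).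
Local Notation plane := (measurableTypeR R * measurableTypeR R)%type.
Local Notation mu := (@lebesgue_measure R).

Lemma integral_chord_deriv (G g : R -> R) (r y : R) :
  (forall x, x ^+ 2 + y ^+ 2 <= r ^+ 2 -> is_derive x 1 G (g x)) ->
  (forall x, x ^+ 2 + y ^+ 2 <= r ^+ 2 -> {for x, continuous g}) ->
  (forall x, x ^+ 2 + y ^+ 2 = r ^+ 2 -> G x = 0) ->
  (\int[mu]_(x in [set x : R | (x ^+ 2 + y ^+ 2 <= r ^+ 2)%R]) (g x)%:E = 0)%E.
Proof.
move=> dG cg G0; have [ry|ry|ry] := ltgtP (y ^+ 2) (r ^+ 2).
- pose s := Num.sqrt (r ^+ 2 - y ^+ 2).
  have s0 : 0 < s by rewrite sqrtr_gt0 subr_gt0.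
  have s2 : s ^+ 2 = r ^+ 2 - y ^+ 2 by rewrite sqr_sqrtr// subr_ge0 ltW.
  have sP x : (x ^+ 2 + y ^+ 2 <= r ^+ 2) = (- s <= x <= s).
    rewrite -ler_norml -[RHS](@ler_pXn2r _ 2) ?nnegrE ?(ltW s0)//.
    by rewrite real_normK ?num_real// s2 lerBrDr.
  have -> : [set x | x ^+ 2 + y ^+ 2 <= r ^+ 2] = `[- s, s]%classic.
    by apply/seteqP; split => x /=; rewrite in_itv/= sP.
  have dG' x : - s <= x <= s -> is_derive x 1 G (g x).
    by rewrite -sP; exact: dG.
  have cG x : - s <= x <= s -> {for x, continuous G}.
    by move=> /dG'[+ _] => /derivable1_diffP/differentiable_continuous.
  rewrite (@continuous_FTC2 _ g G); last first.
  + by move=> x /[!in_itv]/= /andP[/ltW a /ltW b]; have [_ <-] := dG' x ltac:(rewrite a b//); rewrite derive1E.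
  + split.
    * by move=> x /[!in_itv]/= /andP[/ltW a /ltW b]; have [] := dG' x ltac:(rewrite a b//).
    * by apply: cvg_at_right_filter; apply: cG; lra.
    * by apply: cvg_at_left_filter; apply: cG; lra.
  + apply: continuous_in_subspaceT => x /set_mem/=; rewrite in_itv/= -sP; exact: cg.
  + by lra.
  by rewrite !G0 ?subee// ?sqrrN s2; lra.
(* the chord is empty *)
- rewrite (_ : [set x | _] = set0) ?integral_set0//.
  by apply/seteqP; split => x //=; have := sqr_ge0 x; lra.
(* the chord degenerates to a point of the circle *)
- rewrite (_ : [set x | _] = [set 0]) ?integral_set1//.
  apply/seteqP; split => x /=; last by move=> ->; rewrite expr0n/= ry; lra.
  rewrite ry => x0; apply/eqP; rewrite -sqrf_eq0 eq_le sqr_ge0 andbT; lra.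
Qed.

(** Green's formula on a disk for a function vanishing on the circle: on each
    horizontal chord the derivative integrates to zero. *)
Lemma integral_disk_deriv_x (G g : R * R -> R) (r : R) : 0 <= r ->
  (forall p, closed_disk r p ->
     is_derive p.1 1 (fun s => G (s, p.2)) (g p)) ->
  (forall p, closed_disk r p -> {for p, continuous g}) ->
  (forall p, p.1 ^+ 2 + p.2 ^+ 2 = r ^+ 2 -> G p = 0) ->
  (\int[lebesgue2 R]_(p in closed_disk r) (g p)%:E = 0)%E.
Proof.
move=> r0 dG cg G0.
have ig := continuous_closed_disk_integrable r0 cg.
rewrite integral_mkcond.
have mK := measurable_closed_disk r.
have ig2 := (integrable_mkcond _ mK).1 ig.
rewrite /lebesgue2/= -integral21_prod_meas1/=; last first.
  exact: ig2.
rewrite integral0_eq// => y _; rewrite /fubini_G.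
apply: (etrans _ (@integral_chord_deriv (fun x => G (x, y)) (fun x => g (x, y)) r y _ _ _)).
- rewrite [RHS]integral_mkcond; apply: eq_integral => x _.
  rewrite !patchE; congr (if _ then _ else _).
- by move=> x xr; exact: (dG (x, y)).
- move=> x xr; apply: (@continuous_comp _ _ _ (fun x : R => (x, y)) g).
    move=> A /nbhs_ballP[e /= e0 h]; apply/nbhs_ballP; exists e => // t xt.
    by apply: h; split => //=; exact: ballxx.
  exact: cg.
- by move=> x xr; exact: (G0 (x, y)).
Qed.

Lemma integral_disk_deriv_y (G g : R * R -> R) (r : R) : 0 <= r ->
  (forall p, closed_disk r p ->
     is_derive p.2 1 (fun s => G (p.1, s)) (g p)) ->
  (forall p, closed_disk r p -> {for p, continuous g}) ->
  (forall p, p.1 ^+ 2 + p.2 ^+ 2 = r ^+ 2 -> G p = 0) ->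
  (\int[lebesgue2 R]_(p in closed_disk r) (g p)%:E = 0)%E.
Proof.
move=> r0 dG cg G0.
have ig := continuous_closed_disk_integrable r0 cg.
rewrite integral_mkcond.
have mK := measurable_closed_disk r.
have ig2 := (integrable_mkcond _ mK).1 ig.
rewrite /lebesgue2/= -integral12_prod_meas1/=; last first.
  exact: ig2.
rewrite integral0_eq// => x _; rewrite /fubini_F.
apply: (etrans _ (@integral_chord_deriv (fun y => G (x, y)) (fun y => g (x, y)) r x _ _ _)).
- rewrite [RHS]integral_mkcond; apply: eq_integral => y _.
  rewrite !patchE; congr (if _ then _ else _).
  apply/idP/idP => h; apply/mem_set; move/set_mem: h.
    by rewrite /closed_disk/= addrC.
  by rewrite /closed_disk/= addrC.
- by move=> y yr; apply: (dG (x, y)); rewrite /closed_disk/= addrC.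
- move=> y yr; apply: (@continuous_comp _ _ _ (fun y : R => (x, y)) g).
    move=> A /nbhs_ballP[e /= e0 h]; apply/nbhs_ballP; exists e => // t xt.
    by apply: h; split => //=; exact: ballxx.
  by apply: cg; rewrite /closed_disk/= addrC.
- by move=> y yr; apply: (G0 (x, y)); rewrite /= addrC.
Qed.

Lemma closed_disk_normc_lt1 (r : R) (p : plane) : 0 <= r -> r < 1 ->
  closed_disk r p -> normc (of_plane p) < 1.
Proof.
move=> r0 r1 pr; rewrite /= (le_lt_trans _ r1)// -[leRHS](ger0_norm r0).
by rewrite -sqrtr_sqr ler_sqrt// sqr_ge0.
Qed.

(** The real and imaginary parts of the formula for [F_x + i F_y], which is
    twice the derivative of [F] with respect to the conjugate variable. *)
Lemma integral_disk_dbar (F Fx Fy H : C -> C) (r : R) : 0 <= r -> r < 1 ->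
  (forall z, normc z < 1 -> C1_at F Fx Fy z) ->
  (forall z, normc z = r -> F z = 0) ->
  (forall z, Fx z + 'i%C * Fy z = H z) ->
  (\int[lebesgue2 R]_(p in closed_disk r) (Re (H (of_plane p)))%:E = 0)%E /\
  (\int[lebesgue2 R]_(p in closed_disk r) (Im (H (of_plane p)))%:E = 0)%E.
Proof.
move=> r0 r1 CF F0 FH.
have K1 p : closed_disk r p -> normc (of_plane p) < 1.
  exact: closed_disk_normc_lt1.
have Fr (p : R * R) : p.1 ^+ 2 + p.2 ^+ 2 = r ^+ 2 -> F (of_plane p) = 0.
  by move=> pr; apply: F0; rewrite /= pr sqrtr_sqr ger0_norm.
pose a p := Re (Fx (of_plane p)). pose b p := Im (Fx (of_plane p)).
pose c p := Re (Fy (of_plane p)). pose d p := Im (Fy (of_plane p)).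
have ca p : closed_disk r p -> {for p, continuous a}.
  by move=> /K1/CF[_ [+ _] _ _ _]; case: p.
have cb p : closed_disk r p -> {for p, continuous b}.
  by move=> /K1/CF[_ [_ +] _ _ _]; case: p.
have cc p : closed_disk r p -> {for p, continuous c}.
  by move=> /K1/CF[_ _ [+ _] _ _]; case: p.
have cd p : closed_disk r p -> {for p, continuous d}.
  by move=> /K1/CF[_ _ [_ +] _ _]; case: p.
have Ia : (\int[lebesgue2 R]_(p in closed_disk r) (a p)%:E = 0)%E.
  apply: (@integral_disk_deriv_x (fun p => Re (F (of_plane p)))) => //.
    by move=> p /K1/CF[_ _ _ [+ _] _].
  by move=> p /Fr ->.
have Ib : (\int[lebesgue2 R]_(p in closed_disk r) (b p)%:E = 0)%E.
  apply: (@integral_disk_deriv_x (fun p => Im (F (of_plane p)))) => //.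
    by move=> p /K1/CF[_ _ _ [_ +] _].
  by move=> p /Fr ->.
have Ic : (\int[lebesgue2 R]_(p in closed_disk r) (c p)%:E = 0)%E.
  apply: (@integral_disk_deriv_y (fun p => Re (F (of_plane p)))) => //.
    by move=> p /K1/CF[_ _ _ _ [+ _]].
  by move=> p /Fr ->.
have Id : (\int[lebesgue2 R]_(p in closed_disk r) (d p)%:E = 0)%E.
  apply: (@integral_disk_deriv_y (fun p => Im (F (of_plane p)))) => //.
    by move=> p /K1/CF[_ _ _ _ [_ +]].
  by move=> p /Fr ->.
have mK := measurable_closed_disk r.
have ia := continuous_closed_disk_integrable r0 ca.
have ib := continuous_closed_disk_integrable r0 cb.
have ic := continuous_closed_disk_integrable r0 cc.
have id := continuous_closed_disk_integrable r0 cd.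
split.
  rewrite (_ : (fun _ => _) = (fun p => (a p)%:E - (d p)%:E)%E).
    by rewrite integralB// Ia Id subee.
  apply/funext => p; rewrite -FH ReD ReM/= -EFinB; congr EFin.
  by rewrite /a /d; ring.
rewrite (_ : (fun _ => _) = (fun p => (b p)%:E + (c p)%:E)%E).
  by rewrite integralD// Ib Ic adde0.
apply/funext => p; rewrite -FH ImD ImM/= -EFinD; congr EFin.
by rewrite /b /c; ring.
Qed.

End Green.

(** * Normalized area measure *)

Section NormalizedArea.
Variable R : realType.
Local Notation plane := (measurableTypeR R * measurableTypeR R)%type.
Local Notation D := (@plane_disk R).
Local Notation mD := (@measurable_plane_disk R).
Local Notation nu := (lebesgue2 R).
Local Notation dA := (dA R).

Definition square (p : plane) (e : R) : set plane :=
  `](p.1 : R) - e, (p.1 : R) + e[%classic `*` `](p.2 : R) - e, (p.2 : R) + e[%classic.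

Lemma measurable_square p e : measurable (square p e).
Proof. by apply: measurableX; exact: measurable_itv. Qed.

Lemma lebesgue2_square p e : 0 < e -> nu (square p e) = ((2 * e) ^+ 2)%:E.
Proof.
move=> e0; rewrite /lebesgue2/= product_measure1E ?measurable_itv//=.
rewrite !lebesgue_measure_itv/= !lte_fin.
have lt_e (x : R) : x - e < x + e by lra.
by rewrite !lt_e -!EFinD -EFinM; congr EFin; ring.
Qed.

Lemma lebesgue2_disk_fin : (nu D < +oo)%E.
Proof.
apply: le_lt_trans (lebesgue2_closed_disk 1).
apply: le_measure; rewrite ?inE; [exact: mD|exact: measurable_closed_disk|].
by move=> p /plane_diskE; rewrite /closed_disk/= expr1n => /ltW.
Qed.

Lemma lebesgue2_disk_gt0 : 0 < fine (nu D).
Proof.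
apply: fine_gt0; rewrite lebesgue2_disk_fin andbT.
apply: (@lt_le_trans _ _ (nu (square (0, 0) (1 / 2)))).
  by rewrite lebesgue2_square ?lte_fin; nra.
apply: le_measure; rewrite ?inE; [exact: measurable_square|exact: mD|].
move=> [x y] [/=]; rewrite !in_itv/= => /andP[a b] /andP[c d].
by apply/plane_diskE => /=; nra.
Qed.

Lemma dAE A : dA A = (((fine (nu D))^-1)%:E * nu A)%E.
Proof. by []. Qed.

Lemma dA_disk_fin : (dA D < +oo)%E.
Proof.
by rewrite dAE lte_mul_pinfty// ?lebesgue2_disk_fin// lee_fin invr_ge0.
Qed.

Lemma dA_square_gt0 p e : 0 < e -> (0 < dA (square p e))%E.
Proof.
move=> e0; rewrite dAE lebesgue2_square// -EFinM lte_fin mulr_gt0//.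
  by rewrite invr_gt0 lebesgue2_disk_gt0.
by rewrite exprn_gt0// mulr_gt0.
Qed.

Lemma integral_dA_eq0 (A : set plane) (f : plane -> R) : measurable A ->
  nu.-integrable A (EFin \o f) ->
  (\int[nu]_(p in A) (f p)%:E = 0)%E -> (\int[dA]_(p in A) (f p)%:E = 0)%E.
Proof.
move=> mA intf f0; have mf := measurable_int _ intf.
rewrite integralE !ge0_integral_mscale//.
- rewrite -muleBr//; last first.
    by rewrite fin_num_adde_defr//; exact: integrable_pos_fin_num.
  by rewrite -integralE f0 mule0.
- exact: measurable_funeneg.
- exact: measurable_funepos.
Qed.

(** Complex conjugation, seen on the real plane; that it preserves area is
    what makes composition with conjugation act on square-integrable
    functions. *)
Definition reflect (p : plane) : plane := (p.1, - (p.2 : R)).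

Lemma measurable_reflect : measurable_fun setT reflect.
Proof.
apply/measurable_fun_pairP; split; first exact: measurable_fst.
exact: (measurableT_comp (@oppr_measurable R setT) measurable_snd).
Qed.

HB.instance Definition _ :=
  isMeasurableFun.Build _ _ _ _ reflect measurable_reflect.

Lemma lebesgue2_reflect (A : set plane) : measurable A ->
  pushforward nu reflect A = nu A.
Proof.
move=> mA; rewrite /lebesgue2; apply/esym.
apply: (@product_measure_unique _ _ _ _ _ _ _ (pushforward nu reflect)) => //.
move=> B E mB mE.
have mE' : measurable ((-%R : R -> R) @^-1` E : set (measurableTypeR R)).
  by rewrite -[X in measurable X]setTI; exact: (@oppr_measurable R setT).
transitivity (nu (B `*` ((-%R : R -> R) @^-1` E))); first by [].
rewrite /lebesgue2/= product_measure1E//.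
by congr (_ * _)%E; exact: lebesgue_measureN.
Qed.

Lemma disk_reflect p : D (reflect p) <-> D p.
Proof. by rewrite !plane_diskE /= sqrrN. Qed.

Lemma ge0_integral_dA_reflect (f : plane -> \bar R) : measurable_fun D f ->
  (forall p, D p -> 0 <= f p)%E ->
  (\int[dA]_(p in D) f (reflect p) = \int[dA]_(p in D) f p)%E.
Proof.
move=> mf f0.
have preD : reflect @^-1` D = D.
  by apply/seteqP; split => p /= /disk_reflect.
rewrite !ge0_integral_mscale//; last 4 first.
- exact: mD.
- exact: mD.
- apply: (measurable_comp mD) => //; last exact: measurable_funS measurable_reflect.
  by move=> _ [p Dp <-]; exact/disk_reflect.
- by move=> p Dp; apply: f0; exact/disk_reflect.
congr (_ * _)%E; rewrite -{1}preD.
rewrite -(@ge0_integral_pushforward _ _ _ _ _ _ measurable_reflect nu D f mD mf).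
  by apply: eq_measure_integral => A mA _; exact: lebesgue2_reflect.
by move=> p /set_mem; exact: f0.
Qed.

End NormalizedArea.

(** * Square-integrable functions on the disk *)

Section SquareIntegrable.
Variable R : realType.
Local Notation C := R[i].
Local Notation normc := (@normc R).
Local Notation Re := (@complex.Re R).
Local Notation Im := (@complex.Im R).
Local Notation plane := (measurableTypeR R * measurableTypeR R)%type.
Local Notation D := (@plane_disk R).
Local Notation mD := (@measurable_plane_disk R).
Local Notation dA := (dA R).
Implicit Types (f g h u : C -> C).

(** Functions on the disk are represented by total functions, so this is the
    equality that matters. *)
Definition eq_disk f g := forall z, normc z < 1 -> f z = g z.

Lemma eq_disk_plane f g p : eq_disk f g -> D p ->
  f (of_plane p) = g (of_plane p).
Proof. by move=> fg /unit_diskE; exact: fg. Qed.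

Lemma eq_disk_sym f g : eq_disk f g -> eq_disk g f.
Proof. by move=> fg z z1; rewrite fg. Qed.

Lemma cmeasurable_ext f g : eq_disk f g -> cmeasurable f -> cmeasurable g.
Proof.
move=> fg [mf1 mf2]; split; [apply: eq_measurable_fun mf1|apply: eq_measurable_fun mf2];
  by move=> p /set_mem Dp; rewrite (eq_disk_plane fg Dp).
Qed.

Lemma cmeasurableD f g : cmeasurable f -> cmeasurable g ->
  cmeasurable (fun z => f z + g z).
Proof.
move=> [f1 f2] [g1 g2]; split.
  under eq_fun do rewrite ReD; exact: measurable_funD.
under eq_fun do rewrite ImD; exact: measurable_funD.
Qed.

Lemma cmeasurableM f g : cmeasurable f -> cmeasurable g ->
  cmeasurable (fun z => f z * g z).
Proof.
move=> [f1 f2] [g1 g2]; split.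
  under eq_fun do rewrite ReM.
  by apply: measurable_funB; exact: measurable_funM.
under eq_fun do rewrite ImM.
by apply: measurable_funD; exact: measurable_funM.
Qed.

Lemma cmeasurable_cst a : cmeasurable (fun=> a : C).
Proof. by split; exact: measurable_cst. Qed.

Lemma Re_conj (z : C) : Re z^* = Re z. Proof. by case: z. Qed.
Lemma Im_conj (z : C) : Im z^* = - Im z. Proof. by case: z. Qed.

Lemma cmeasurable_conj f : cmeasurable f -> cmeasurable (fun z => (f z)^*).
Proof.
move=> [f1 f2]; split; first by under eq_fun do rewrite Re_conj.
under eq_fun do rewrite Im_conj.
exact: (measurableT_comp (@oppr_measurable R setT) f2).
Qed.

Lemma cmeasurable_ccont f : (forall z, normc z < 1 -> ccont f z) ->
  cmeasurable f.
Proof.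
move=> cf; split; apply: (measurable_fun_continuous_at mD) => -[x y] /unit_diskE/cf.
  by case.
by case.
Qed.

Lemma measurable_sqr_normc f : cmeasurable f ->
  measurable_fun D (fun p => normc (f (of_plane p)) ^+ 2).
Proof.
move=> [f1 f2]; under eq_fun do rewrite sqr_normcE.
by apply: measurable_funD; exact: measurable_funX.
Qed.

Lemma L2_integrable f : L2 f <-> cmeasurable f /\
  dA.-integrable D (EFin \o (fun p => normc (f (of_plane p)) ^+ 2)).
Proof.
have E : (\int[dA]_(p in D) `|(normc (f (of_plane p)) ^+ 2)%:E| =
    \int[dA]_(p in D) (normc (f (of_plane p)) ^+ 2)%:E)%E.
  by apply: eq_integral => p _; rewrite /= ger0_norm ?sqr_ge0.
split => -[mf fi]; split => //.
  apply/integrableP; split; first apply/measurable_EFinP. exact (measurable_sqr_normc mf).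
  by rewrite E.
by move/integrableP: fi => [_]; rewrite E.
Qed.

Lemma L2_ext f g : eq_disk f g -> L2 f -> L2 g.
Proof.
move=> fg [mf fi]; split; first exact: cmeasurable_ext mf.
rewrite (_ : integral _ _ _ = (\int[dA]_(p in D) (normc (f (of_plane p)) ^+ 2)%:E)%E)//.
by apply: eq_integral => p /set_mem Dp; rewrite (eq_disk_plane fg Dp).
Qed.

Lemma L2_le f g h (K : R) : cmeasurable h -> L2 f -> L2 g ->
  (forall p, D p -> normc (h (of_plane p)) ^+ 2 <=
    K * (normc (f (of_plane p)) ^+ 2 + normc (g (of_plane p)) ^+ 2)) -> L2 h.
Proof.
move=> mh /L2_integrable[mf fi] /L2_integrable[mg gi] hle.
apply/L2_integrable; split => //.
apply: (@le_integrable _ _ _ _ _ mD _ (EFin \o (fun p =>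
    K * (normc (f (of_plane p)) ^+ 2 + normc (g (of_plane p)) ^+ 2)))).
- apply/measurable_EFinP; exact (measurable_sqr_normc mh).
- move=> p Dp; rewrite /= lee_fin ger0_norm ?sqr_ge0//.
  by rewrite (le_trans (hle p Dp))// ler_norm.
- by have := integrableZl mD K (integrableD mD fi gi).
Qed.

Lemma L2_lin (c : C) f g : L2 f -> L2 g -> L2 (fun z => c * f z + g z).
Proof.
move=> Lf Lg.
apply: (@L2_le f g _ (2 * (normc c ^+ 2 + 1))) => //.
  apply: cmeasurableD; last by case: Lg.
  by apply: cmeasurableM; [exact: cmeasurable_cst|case: Lf].
move=> p _; set x := f _; set y := g _.
have := normcD (c * x) y; rewrite normcM.
move: (normc_ge0 (c * x + y)) (normc_ge0 c) (normc_ge0 x) (normc_ge0 y).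
move: (normc (_ + _)) (normc c) (normc x) (normc y) => s a b d s0 a0 b0 d0 h.
have h2 : s ^+ 2 <= (a * b + d) ^+ 2 by rewrite lerXn2r ?nnegrE// (le_trans s0).
rewrite (le_trans h2)//.
have := sqr_ge0 (a * b - d); have := sqr_ge0 b; have := sqr_ge0 (a * d).
nra.
Qed.

Lemma L2_bounded f (M : R) : cmeasurable f ->
  (forall z, normc z < 1 -> normc (f z) <= M) -> L2 f.
Proof.
move=> mf fM; apply/L2_integrable; split => //.
apply: measurable_bounded_integrable.
- exact: mD.
- exact: dA_disk_fin.
- exact (measurable_sqr_normc mf).
- exists (M ^+ 2); split; first exact: num_real.
  move=> x Mx p /= /unit_diskE /fM le; rewrite ger0_norm ?sqr_ge0//.
  rewrite (le_trans _ (ltW Mx))// lerXn2r ?nnegrE ?normc_ge0//.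
  exact: le_trans (normc_ge0 _) le.
Qed.

Lemma L2_mul_bounded (phi f : C -> C) (M : R) : cmeasurable phi -> L2 f ->
  (forall z, normc z < 1 -> normc (phi z) <= M) -> L2 (fun z => phi z * f z).
Proof.
move=> mphi Lf phiM; apply: (@L2_le f f _ (M ^+ 2)) => //.
  by apply: cmeasurableM => //; case: Lf.
move=> p /unit_diskE/phiM le; rewrite normcM exprMn mulrDr.
have : normc (phi (of_plane p)) ^+ 2 <= M ^+ 2.
  rewrite lerXn2r ?nnegrE ?normc_ge0//.
  exact: le_trans (normc_ge0 _) le.
move=> h; have := ler_wpM2r (sqr_ge0 (normc (f (of_plane p)))) h.
by have := mulr_ge0 (sqr_ge0 M) (sqr_ge0 (normc (f (of_plane p)))); lra.
Qed.

Lemma L2_cst (c : C) : L2 (fun=> c).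
Proof. by apply: (@L2_bounded _ (normc c)) => //; exact: cmeasurable_cst. Qed.

Lemma L2_Jop f : L2 f -> L2 (Jop f).
Proof.
move=> [[f1 f2] fi]; have mr := measurable_funS measurableT (@subsetT _ D) (@measurable_reflect R).
have rD : @reflect R @` D `<=` D by move=> _ [p Dp <-]; exact/disk_reflect.
split.
  by split; [exact: (measurable_comp mD rD f1 mr)|exact: (measurable_comp mD rD f2 mr)].
have E := @ge0_integral_dA_reflect R (fun q => (normc (f (of_plane q)) ^+ 2)%:E).
move: fi; rewrite -E//.
  by apply/measurable_EFinP; exact (measurable_sqr_normc (conj f1 f2)).
by move=> p _; rewrite lee_fin sqr_ge0.
Qed.

Definition cintegrable (F : C -> C) : Prop :=
  dA.-integrable D (EFin \o (fun p => Re (F (of_plane p)))) /\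
  dA.-integrable D (EFin \o (fun p => Im (F (of_plane p)))).

(** [2 |f g| <= |f| ^ 2 + |g| ^ 2]. *)
Lemma L2_mul_integrable f g : L2 f -> L2 g ->
  cintegrable (fun z => f z * (g z)^*).
Proof.
move=> /L2_integrable[mf fi] /L2_integrable[mg gi].
have [m1 m2] := cmeasurableM mf (cmeasurable_conj mg).
have H p : normc (f (of_plane p) * (g (of_plane p))^*) <=
    normc (f (of_plane p)) ^+ 2 + normc (g (of_plane p)) ^+ 2.
  rewrite normcM normc_conj.
  have := sqr_ge0 (normc (f (of_plane p)) - normc (g (of_plane p))).
  have := mulr_ge0 (normc_ge0 (f (of_plane p))) (normc_ge0 (g (of_plane p))).
  nra.
have I := integrableD mD fi gi.
split; apply: (le_integrable mD _ _ I).
- exact/measurable_EFinP.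
- move=> p Dp; rewrite /= lee_fin; apply: le_trans (ler_norm _).
  exact: le_trans (Re_le_normc _) (H p).
- exact/measurable_EFinP.
- move=> p Dp; rewrite /= lee_fin; apply: le_trans (ler_norm _).
  exact: le_trans (Im_le_normc _) (H p).
Qed.

Lemma cintegral_ext F G : eq_disk F G -> cintegral F = cintegral G.
Proof.
move=> FG; rewrite /cintegral; congr (_ +i* _); apply: eq_Rintegral => p /set_mem Dp;
  by rewrite (eq_disk_plane FG Dp).
Qed.

Lemma Rintegral_lin3 (k l : R) (f g h : plane -> R) :
  dA.-integrable D (EFin \o f) -> dA.-integrable D (EFin \o g) ->
  dA.-integrable D (EFin \o h) ->
  Rintegral dA D (fun p => k * f p + l * g p + h p) =
  k * Rintegral dA D f + l * Rintegral dA D g + Rintegral dA D h.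
Proof.
move=> fi gi hi.
have kf := integrableZl mD k fi; have lg := integrableZl mD l gi.
have kfi : dA.-integrable D (EFin \o (fun p => k * f p)) by exact: kf.
have lgi : dA.-integrable D (EFin \o (fun p => l * g p)) by exact: lg.
have kl := integrableD mD kf lg.
have kli : dA.-integrable D (EFin \o (fun p => k * f p + l * g p)) by exact: kl.
rewrite -(RintegralZl _ mD fi) -(RintegralZl _ mD gi).
by rewrite -(RintegralD mD kfi lgi) -(RintegralD mD kli hi).
Qed.

Lemma cintegral_lin (c : C) F G : cintegrable F -> cintegrable G ->
  cintegral (fun z => c * F z + G z) = c * cintegral F + cintegral G.
Proof.
move=> [F1 F2] [G1 G2]; rewrite /cintegral.
apply/eqP; rewrite eq_complex; apply/andP; split; apply/eqP.
  rewrite ReD ReM/= -mulNr -(Rintegral_lin3 _ _ F1 F2 G1).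
  by apply: eq_Rintegral => p _; rewrite ReD ReM mulNr.
rewrite ImD ImM/= -(Rintegral_lin3 _ _ F2 F1 G2).
by apply: eq_Rintegral => p _; rewrite ImD ImM.
Qed.

Lemma inner_lin (c : C) f g u : L2 f -> L2 g -> L2 u ->
  inner (fun z => c * f z + g z) u = c * inner f u + inner g u.
Proof.
move=> Lf Lg Lu; rewrite /inner -cintegral_lin; last 2 first.
- exact: L2_mul_integrable.
- exact: L2_mul_integrable.
by apply: cintegral_ext => z _; ring.
Qed.

Lemma inner_ext f g u v : eq_disk f g -> eq_disk u v -> inner f u = inner g v.
Proof. by move=> fg uv; apply: cintegral_ext => z z1; rewrite fg// uv. Qed.

Lemma Re_inner_self f : Re (inner f f) =
  Rintegral dA D (fun p => normc (f (of_plane p)) ^+ 2).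
Proof.
apply: eq_Rintegral => p _; rewrite sqr_normcE ReM Re_conj Im_conj.
by rewrite mulrN opprK !expr2.
Qed.

(** A continuous function that is nonzero at a point stays large on a small
    square around it, and squares have positive area. *)
Lemma inner_self_eq0 f : L2 f -> (forall z, normc z < 1 -> ccont f z) ->
  Re (inner f f) = 0 -> eq_disk f (fun=> 0).
Proof.
move=> Lf cf; rewrite Re_inner_self => f0 z z1.
have /L2_integrable[mf fi] := Lf.
apply/eqP/negP => /negP fz0.
pose N (p : R * R) := normc (f (of_plane p)) ^+ 2.
pose p0 : R * R := (Re z, Im z).
have Nz : 0 < N p0.
  rewrite /N exprn_gt0// lt_neqAle normc_ge0 andbT eq_sym.
  apply/negP => /eqP/eq0_normc; rewrite /of_plane/= => h.
  by move: fz0; rewrite (_ : z = Re z +i* Im z) ?h ?eqxx//; case: (z).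
have cN : {for p0, continuous N}.
  have [c1 c2] := cf _ z1.
  rewrite /N (_ : (fun _ => _) = (fun p : R * R => Re (f (of_plane p)) * Re (f (of_plane p)) +
     Im (f (of_plane p)) * Im (f (of_plane p)))).
    by apply: continuousD; exact: continuousM.
  by apply/funext => p; rewrite sqr_normcE !expr2.
have oD : open (D : set (R * R)).
  rewrite (_ : D = (fun p : R * R => p.1 ^+ 2 + p.2 ^+ 2) @^-1` `]-oo, 1[%classic :> set (R * R)).
    apply: open_comp; first by move=> p _; exact: continuous_sqr_sum.
    exact: interval_open.
  by apply/seteqP; split => p; rewrite /= in_itv/= => /plane_diskE.
have : \forall p \near nbhs p0, D p /\ N p0 / 2 < N p.
  apply: filterS2.
  - by move=> p; exact: conj.
  - apply: open_nbhs_nbhs; split => //; apply/unit_diskE => /=.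
    by case: (z) z1.
  - have := cN; move/cvgrPdist_lt => /(_ (N p0 / 2)).
    have -> : 0 < N p0 / 2 by rewrite divr_gt0.
    move=> /(_ isT); apply: filterS => p; rewrite ltr_norml => /andP[]; lra.
move=> /nbhs_ballP[e /= e0 He].
have Sq : square p0 e `<=` (D `&` [set p | N p0 / 2 < N p]).
  move=> p [/=]; rewrite !in_itv/= => /andP[a b] /andP[c d].
  by apply: He; split => /=; rewrite /ball/= ltr_norml; lra.
have mS : measurable (square p0 e) := measurable_square p0 e.
have : (0 < \int[dA]_(p in D) (N p)%:E)%E.
  apply: (@lt_le_trans _ _ (\int[dA]_(p in square p0 e) (cst (N p0 / 2)%:E p))%E).
    rewrite integral_cst//; apply: mule_gt0; last exact: dA_square_gt0.
    by rewrite lte_fin divr_gt0.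
  apply: (@le_trans _ _ (\int[dA]_(p in square p0 e) (N p)%:E)%E).
    apply: ge0_le_integral; first exact: mS.
    - by move=> p _; rewrite lee_fin divr_ge0// ltW.
    - exact: measurable_cst.
    - apply/measurable_EFinP; apply: (measurable_funS mD _ (measurable_sqr_normc mf)).
      by move=> p /Sq[].
    - by move=> p /Sq[_ /ltW]; rewrite lee_fin.
  apply: ge0_subset_integral => //.
  - exact: mD.
  - apply/measurable_EFinP; exact (measurable_sqr_normc mf).
  - by move=> p _; rewrite lee_fin sqr_ge0.
  - by move=> p /Sq[].
move=> /gt_eqF/negP; apply; apply/eqP.
rewrite -(fineK (integrable_fin_num mD fi)).
by have -> : fine (\int[dA]_(p in D) (EFin \o N) p)%E = 0 by exact: f0.
Qed.

End SquareIntegrable.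

(** * The Bergman projection *)

Section BergmanProjection.
Variable R : realType.
Local Notation C := R[i].
Local Notation normc := (@normc R).
Local Notation Re := (@complex.Re R).
Implicit Types (f g h u : C -> C).

Lemma analytic_onP f : analytic_on (@unit_disk R) f <->
  forall a, normc a < 1 -> exists (c : nat -> C) (t : R), 0 < t /\
    forall z, normc (z - a) < t ->
      (series (fun n => c n * (z - a) ^+ n) : nat -> C^o) @ \oo
        --> (f z : C^o).
Proof.
split => [an a /unit_diskE/an[c [r [r0 cu]]]|an a /unit_diskE/an[c [t [t0 ct]]]].
  case: r r0 cu => t y; rewrite ltcE/= => /andP[/eqP -> t0] cu.
  exists c, t; split => // z za; apply: cu.
  by rewrite normrE ltcR.
exists c, t%:C; split; first by rewrite ltcR.
by move=> z; rewrite normrE ltcR; exact: ct.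
Qed.

Lemma analytic_lin (k : C) f g : analytic_on (@unit_disk R) f ->
  analytic_on (@unit_disk R) g ->
  analytic_on (@unit_disk R) (fun z => k * f z + g z).
Proof.
move=> /analytic_onP fan /analytic_onP gan; apply/analytic_onP => a a1.
have [c [t [t0 ct]]] := fan a a1; have [d [s [s0 ds]]] := gan a a1.
exists (fun n => k * c n + d n), (Num.min t s); split; first by rewrite lt_min t0.
move=> z; rewrite lt_min => /andP[/ct zt /ds zs].
rewrite (_ : series _ = (fun n => k * series (fun n => c n * (z - a) ^+ n) n
    + series (fun n => d n * (z - a) ^+ n) n)).
  exact: cvg_normc_lin zt zs.
apply/funext => n; rewrite /series/= mulr_sumr -big_split/=.
by apply: eq_bigr => i _; ring.
Qed.

Lemma analytic_ext f g : eq_disk f g -> analytic_on (@unit_disk R) f ->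
  analytic_on (@unit_disk R) g.
Proof.
move=> fg /analytic_onP fan; apply/analytic_onP => a a1.
have [c [t [t0 ct]]] := fan a a1.
(* the ball is shrunk to stay inside the unit disk, where [f] and [g] agree *)
exists c, (Num.min t (1 - normc a)); split; first by rewrite lt_min t0 subr_gt0.
move=> z; rewrite lt_min => /andP[zt za]; rewrite -fg; first exact: ct.
by rewrite -[z](subrK a) (le_lt_trans (normcD _ _))// -ltrBrDr.
Qed.

Lemma analytic_monomial N : analytic_on (@unit_disk R) (fun z => z ^+ N).
Proof.
apply/analytic_onP => a _; exists (fun n => a ^+ (N - n) *+ 'C(N, n)), 1.
split => // z _; apply: cvg_near_cst; exists N.+1 => // n /= Nn.
rewrite /series/= (@big_cat_nat _ _ _ N.+1)//=.
rewrite [X in _ + X]big_nat_cond [X in _ + X]big1 ?addr0; last first.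
  by move=> i /andP[/andP[Ni _] _]; rewrite bin_small// mulr0n mul0r.
rewrite -{2}[z](subrKC a) exprDn big_mkord; apply: eq_bigr => i _.
by rewrite mulrnAl.
Qed.

Lemma bergman_lin (k : C) f g : bergman f -> bergman g ->
  bergman (fun z => k * f z + g z).
Proof. by move=> [? ?] [? ?]; split; [exact: L2_lin|exact: analytic_lin]. Qed.

Lemma bergman_ext f g : eq_disk f g -> bergman f -> bergman g.
Proof. by move=> fg [? ?]; split; [exact: L2_ext fg _|exact: analytic_ext fg _]. Qed.

Lemma analytic_ccont u : analytic_on (@unit_disk R) u ->
  forall z, normc z < 1 -> ccont u z.
Proof.
by move=> /analytic_strict_diff[du /C1_analytic H] z /H[].
Qed.

Lemma normc_monomial_le1 (z : C) n : normc z < 1 -> normc (z ^+ n) <= 1.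
Proof. by move=> z1; rewrite normcX exprn_ile1 ?normc_ge0// ltW. Qed.

Lemma bergman_monomial n : bergman (fun z : C => z ^+ n).
Proof.
split; last exact: analytic_monomial.
apply: (@L2_bounded _ _ 1) => [|z]; last exact: normc_monomial_le1.
by apply: cmeasurable_ccont => z _; apply: ccontX; exact: ccont_id.
Qed.

Lemma bergman0 : bergman (fun=> 0 : C).
Proof.
have b1 := bergman_monomial 0; apply: bergman_ext (bergman_lin (-1) b1 b1).
by move=> z _; ring.
Qed.

Lemma bergman_scale (k : C) f : bergman f -> bergman (fun z => k * f z).
Proof.
move=> bf; apply: bergman_ext (bergman_lin k bf bergman0).
by move=> z _; rewrite addr0.
Qed.

Lemma bergman_sub f g : bergman f -> bergman g -> bergman (fun z => f z - g z).
Proof.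
move=> bf bg; apply: bergman_ext (bergman_lin (-1) bg bf).
by move=> z _; ring.
Qed.

Lemma L2_sub f g : L2 f -> L2 g -> L2 (fun z => f z - g z).
Proof.
move=> bf bg; apply: L2_ext (L2_lin (-1) bg bf).
by move=> z _; ring.
Qed.

Lemma bergman_inner_self_eq0 f : bergman f -> Re (inner f f) = 0 ->
  eq_disk f (fun=> 0).
Proof. by move=> [Lf /analytic_ccont cf]; exact: inner_self_eq0. Qed.

Lemma is_bergman_proj_lin (c : C) g g' h h' : L2 g -> L2 g' ->
  is_bergman_proj g h -> is_bergman_proj g' h' ->
  is_bergman_proj (fun z => c * g z + g' z) (fun z => c * h z + h' z).
Proof.
move=> Lg Lg' [bh H] [bh' H']; split; first exact: bergman_lin.
move=> u bu; have := inner_lin c (L2_sub Lg bh.1) (L2_sub Lg' bh'.1) bu.1.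
rewrite H// H'// mulr0 addr0 => <-.
by apply: inner_ext => // z _; ring.
Qed.

Lemma is_bergman_proj_ext g g' h h' : eq_disk g g' -> eq_disk h h' ->
  is_bergman_proj g h -> is_bergman_proj g' h'.
Proof.
move=> gg hh [bh H]; split; first exact: bergman_ext hh bh.
move=> u /H <-; apply: inner_ext => // z z1.
by rewrite gg// hh.
Qed.

Lemma is_bergman_proj0 : is_bergman_proj (fun=> 0 : C) (fun=> 0).
Proof.
split; first exact: bergman0.
move=> u bu.
have E := inner_lin (-1) (L2_cst 0) (L2_cst 0) bu.1.
transitivity (-1 * inner (fun=> 0) u + inner (fun=> 0) u).
  by rewrite -E; apply: inner_ext => // z _; ring.
by rewrite mulN1r addNr.
Qed.

(** The difference of two projections lies in the Bergman space and is
    orthogonal to itself. *)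
Lemma is_bergman_proj_unique g h h' : L2 g -> is_bergman_proj g h ->
  is_bergman_proj g h' -> eq_disk h h'.
Proof.
move=> Lg [bh H] [bh' H'].
have bd := bergman_sub bh bh'.
have /(bergman_inner_self_eq0 bd) d0 : Re (inner (fun z => h z - h' z)
    (fun z => h z - h' z)) = 0.
  have := inner_lin (-1) (L2_sub Lg bh.1) (L2_sub Lg bh'.1) bd.1.
  rewrite H// H'// mulr0 addr0 => E.
  rewrite (@inner_ext _ _ (fun z => -1 * (g z - h z) + (g z - h' z)) _
    (fun z => h z - h' z))// ?E//.
  by move=> z _; ring.
by move=> z /d0 /eqP; rewrite subr_eq0 => /eqP.
Qed.

Lemma bergman_projP g h : L2 g -> is_bergman_proj g h ->
  eq_disk (bergman_proj g) h.
Proof.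
move=> Lg gh; apply: (is_bergman_proj_unique Lg) (gh).
exact: (@xgetPex _ (cst 0) [set h | is_bergman_proj g h] (ex_intro _ h gh)).
Qed.

Lemma bergman_bergman_proj g : bergman (bergman_proj g).
Proof.
rewrite /bergman_proj; case: xgetP => [h _ [//]|_]; exact: bergman0.
Qed.

(** The two functions have the same set of projections, so the choice made
    among them is literally the same. *)
Lemma bergman_proj_ext g g' : eq_disk g g' -> bergman_proj g = bergman_proj g'.
Proof.
move=> gg; rewrite /bergman_proj; congr xget; apply/seteqP; split => h /=.
  exact: is_bergman_proj_ext.
by apply: is_bergman_proj_ext => //; exact: eq_disk_sym.
Qed.

(** A nonzero multiple of a function without projection has none either, and
    then both sides vanish. *)
Lemma bergman_projZ (c : C) g : L2 g ->
  eq_disk (bergman_proj (fun z => c * g z)) (fun z => c * bergman_proj g z).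
Proof.
move=> Lg.
have scale (k : C) f h : L2 f -> is_bergman_proj f h ->
    is_bergman_proj (fun z => k * f z) (fun z => k * h z).
  move=> Lf fh.
  apply: is_bergman_proj_ext (is_bergman_proj_lin k Lf (L2_cst 0) fh is_bergman_proj0).
    by move=> z _; rewrite addr0.
  by move=> z _; rewrite addr0.
have Lcg : L2 (fun z => c * g z).
  apply: L2_ext (L2_lin c Lg (L2_cst 0)).
  by move=> z _; rewrite addr0.
have [[h gh]|nh] := pselect (exists h, is_bergman_proj g h).
  move=> z z1; rewrite (bergman_projP Lcg (scale c _ _ Lg gh))//.
  by rewrite (bergman_projP Lg gh).
have [->|c0] := eqVneq c 0.
  move=> z z1; rewrite mul0r; apply: (bergman_projP _ _ z1).
    by apply: L2_ext (L2_cst 0) => w _; rewrite mul0r.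
  by apply: is_bergman_proj_ext is_bergman_proj0 => w _; rewrite ?mul0r.
have E f : (~ exists h, is_bergman_proj f h) -> bergman_proj f = cst 0.
  by move=> nf; rewrite /bergman_proj xgetPN// => h fh; apply: nf; exists h.
rewrite !E//; first by move=> z _ /=; rewrite mulr0.
move=> [h ch]; apply: nh; exists (fun z => c^-1 * h z).
apply: is_bergman_proj_ext (scale c^-1 _ _ Lcg ch) => // z _.
by rewrite mulKf.
Qed.

End BergmanProjection.

(** * The projection of monomials in z and its conjugate *)

Section MonomialProjection.
Variable R : realType.
Local Notation C := R[i].
Local Notation normc := (@normc R).
Local Notation Re := (@complex.Re R).
Local Notation Im := (@complex.Im R).
Local Notation plane := (measurableTypeR R * measurableTypeR R)%type.
Local Notation D := (@plane_disk R).
Local Notation mD := (@measurable_plane_disk R).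
Local Notation dA := (dA R).
Implicit Types (f g h u : C -> C).

Definition radius (n : nat) : R := 1 - harmonic n / 2.

Lemma radius_bounds n : 0 < radius n < 1.
Proof.
have h0 : (0 : R) < harmonic n by rewrite /harmonic /= invr_gt0.
have h1 : (harmonic n : R) <= 1 by rewrite /harmonic /= invf_le1// ler1n.
by rewrite /radius; apply/andP; split; lra.
Qed.

Lemma cvg_radiusX m : (radius n) ^+ m @[n --> \oo] --> (1 : R).
Proof.
have r1 : radius n @[n --> \oo] --> (1 : R).
  rewrite -[X in _ --> X](subr0 1) -[X in _ --> _ - X](mul0r (2^-1)).
  apply: cvgB; first exact: cvg_cst.
  by apply: cvgM; [exact: cvg_harmonic|exact: cvg_cst].
elim: m => [|m IH]; first exact: cvg_cst.
rewrite -[X in _ --> X]mulr1 (_ : (fun _ => _) = (fun n => radius n * radius n ^+ m)).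
  exact: cvgM.
by apply/funext => n; rewrite exprS.
Qed.

(** Dominated convergence along the disks of radius [r < 1]; the weight
    [r ^ m] tends to 1. *)
Lemma integral_disk_exhaustion (A B : plane -> R) (m : nat) :
  dA.-integrable D (EFin \o A) -> dA.-integrable D (EFin \o B) ->
  (forall r, 0 < r -> r < 1 ->
    (\int[dA]_(p in closed_disk r) (A p - r ^+ m * B p)%:E = 0)%E) ->
  (\int[dA]_(p in D) (A p - B p)%:E = 0)%E.
Proof.
move=> iA iB H.
have mA : measurable_fun D A by apply/measurable_EFinP; exact: measurable_int iA.
have mB : measurable_fun D B by apply/measurable_EFinP; exact: measurable_int iB.
pose K n := closed_disk (radius n).
pose F n (p : plane) : \bar R := ((fun p => (A p - radius n ^+ m * B p)%:E) \_ (K n)) p.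
have KD n : K n `<=` D.
  move=> p; rewrite /K /closed_disk/= => h; apply/plane_diskE.
  have /andP[r0 r1] := radius_bounds n.
  by apply: le_lt_trans h _; rewrite exprn_ilt1// ltW.
have mK n : measurable (K n) by exact: measurable_closed_disk.
have F0 n : (\int[dA]_(p in D) F n p = 0)%E.
  rewrite /F -integral_mkcondr setIidr; last exact: KD.
  by have /andP[r0 r1] := radius_bounds n; exact: H.
pose f p := (A p - B p)%:E; pose g p := (`|A p| + `|B p|)%:E.
have mF n : measurable_fun D (F n).
  apply/measurable_restrict; [exact: mK|exact: mD|].
  apply/measurable_EFinP; apply: (measurable_funS mD); first by move=> p [].
  by apply: measurable_funB => //; apply: measurable_funM => //; exact: measurable_cst.
have mf : measurable_fun D f by apply/measurable_EFinP; exact: measurable_funB.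
have Ff : {ae dA, forall p, D p -> F ^~ p @ \oo --> f p}.
  apply: aeW => p /plane_diskE p1.
  have nearK : \forall n \near \oo, F n p = (A p - radius n ^+ m * B p)%:E.
    have := cvg_radiusX 2; move=> /cvgr_gt /(_ _ p1); apply: filterS => n pn.
    by rewrite /F patchE mem_set//; exact: ltW.
  apply: (@cvg_trans _ ((A p - radius n ^+ m * B p)%:E @[n --> \oo])).
    by apply: near_eq_cvg; apply: filterS nearK => n ->.
  apply: cvg_EFin; first by apply: nearW.
  rewrite -[X in _ --> _ - X]mul1r.
  apply: cvgB; first exact: cvg_cst.
  by apply: cvgM; [exact: cvg_radiusX|exact: cvg_cst].
have ig : dA.-integrable D g.
  by have := integrableD mD (integrable_abse iA) (integrable_abse iB).
have Fg : {ae dA, forall p n, D p -> (`|F n p| <= g p)%E}.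
  apply: aeW => p n Dp; rewrite /F patchE; case: ifPn => _.
    rewrite /= lee_fin (le_trans (ler_normB _ _))// lerD2l normrM.
    have /andP[r0 r1] := radius_bounds n.
    by rewrite ler_piMl// ger0_norm ?exprn_ge0 ?exprn_ile1// ltW.
  by rewrite /= normr0 lee_fin addr_ge0.
have [_ _ cF] := dominated_convergence mD mF mf Ff ig Fg.
have /cvg_lim <- // : (fun n => \int[dA]_(p in D) F n p)%E @ \oo --> 0%E.
  by rewrite (_ : (fun _ => _) = cst 0%E); [exact: cvg_cst|apply/funext => n; rewrite F0].
exact/esym/cvg_lim.
Qed.

Lemma mul_conjC (z : C) : z * conjc z = (normc z ^+ 2)%:C.
Proof.
by rewrite sqr_normcE; case: z => x y; apply/eqP; rewrite eq_complex/=; apply/andP; split; apply/eqP; ring.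
Qed.

Lemma sqr_iC : ('i%C : C) * 'i%C = -1.
Proof. by apply/eqP; rewrite eq_complex/=; apply/andP; split; apply/eqP; ring. Qed.

(** The subtraction of natural numbers is truncated, so that the coefficient
    vanishes exactly when [i < q], where the projection is zero. *)
Definition proj_coef (i q : nat) : C := (i.+1 - q)%N%:R / i.+1%:R.

(** The function [v] in the proof vanishes on the circle of radius [r], where
    [z * zbar = r ^ 2]. Twice its derivative with respect to the conjugate
    variable is the conjugate of [z ^ i * zbar ^ q] minus that of the claimed
    projection, the latter with the weight [r ^ (2 * min(q, i + 1))]. As [u] is
    killed by that derivative, Green's formula applies to [v * u]. *)
Lemma integral_closed_disk_monomial u (i q : nat) (r : R) :
  analytic_on (@unit_disk R) u -> 0 < r -> r < 1 ->
  let a z := z ^+ q * conjc z ^+ i * u z in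
  let b z := proj_coef i q * conjc z ^+ (i - q) * u z in
  (\int[dA]_(p in closed_disk r) (Re (a (of_plane p)) -
     r ^+ (2 * minn q i.+1) * Re (b (of_plane p)))%:E = 0)%E /\
  (\int[dA]_(p in closed_disk r) (Im (a (of_plane p)) -
     r ^+ (2 * minn q i.+1) * Im (b (of_plane p)))%:E = 0)%E.
Proof.
move=> an r0 r1 a b; pose t := i.+1; pose m := minn q t.
pose rho : C := (r ^+ (2 * m))%:C.
have [du Hu] := analytic_strict_diff an.
pose k : C := (2 * t%:R)^-1.
pose H z := a z - rho * b z.
have Cu z : normc z < 1 -> C1_at u du (fun w => 'i%C * du w) z by exact: C1_analytic.
have Cm s j (z : C) := C1M (C1X s (C1_id z)) (C1X j (C1_conj z)).
pose v w : C := k * (w ^+ q * conjc w ^+ t + - rho * (w ^+ (q - t) * conjc w ^+ (t - q))).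
have Cv z := C1M (C1_cst k z) (C1D (Cm q t z) (C1M (C1_cst (- rho) z) (Cm (q - t)%N (t - q)%N z))).
have CF z z1 := C1M (Cv z) (Cu z z1).
have F0 z : normc z = r -> v z * u z = 0.
  move=> zr; rewrite /v; suff -> : z ^+ q * conjc z ^+ t =
     rho * (z ^+ (q - t) * conjc z ^+ (t - q)) by rewrite mulNr subrr mulr0 mul0r.
  have -> : rho = z ^+ m * conjc z ^+ m.
    by rewrite -exprMn mul_conjC zr /rho exprM rmorphXn.
  rewrite mulrACA -!exprD /m; congr (_ ^+ _ * _ ^+ _); lia.
have kt : k * (2 * t%:R) = 1.
  by rewrite /k mulVf// mulf_neq0 ?pnatr_eq0.
have ktq : k * 2 * (t - q)%N%:R = proj_coef i q.
  by rewrite /k /proj_coef -/t; field; rewrite !pnatr_eq0.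
have FH : exists Fx Fy, (forall z, normc z < 1 -> C1_at (fun w => v w * u w) Fx Fy z)
    /\ forall z, Fx z + 'i%C * Fy z = H z.
  do 2 eexists; split; first by move=> z z1; exact: (CF z z1).
  move=> z /=.
  set Q := z ^+ q.-1; set T := conjc z ^+ (t - q).-1; set Q' := z ^+ (q - t).-1.
  have -> : H z = k * (2 * (t%:R * z ^+ q * conjc z ^+ i)
      - rho * (2 * ((t - q)%N%:R * (T * z ^+ (q - t))))) * u z.
    rewrite /H /a /b -ktq.
    have -> : (t - q)%N%:R * (T * z ^+ (q - t)) = (t - q)%N%:R * conjc z ^+ (i - q) :> C.
      have [tq|qt] := leqP t q; first by rewrite (eqP tq) !mul0r.
      by rewrite (eqP (ltnW qt)) expr0 mulr1 /T /t subSn.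
    have -> : z ^+ q * conjc z ^+ i * u z =
        k * (2 * t%:R) * (z ^+ q * conjc z ^+ i * u z) by rewrite kt mul1r.
    ring.
  (* [X], [X'] are the holomorphic derivatives of the two terms of [v], which
     cancel since [1 + i ^ 2 = 0]; [Y], [Y'] are the conjugate ones *)
  pose X := q%:R * Q * conjc z ^+ t; pose Y := z ^+ q * (t%:R * conjc z ^+ t.-1).
  pose X' := (q - t)%N%:R * Q' * conjc z ^+ (t - q).
  pose Y' := z ^+ (q - t) * ((t - q)%N%:R * T).
  rewrite -/t (_ : i = t.-1)//.
  apply: (@etrans _ _ ((k * (2 * Y - rho * (2 * Y')) * u z) +
     (1 + 'i%C * 'i%C) * (k * (X - Y - rho * (X' - Y')) * u z + v z * du z))).
    rewrite /v /X /Y /X' /Y'.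
    ring.
  by rewrite sqr_iC subrr mul0r addr0 /Y /Y'; ring.
have [Fx [Fy [C1F FHE]]] := FH.
have [IR II] := integral_disk_dbar (ltW r0) r1 C1F F0 FHE.
have cH z : normc z < 1 -> ccont H z.
  move=> /C1F[_ c1 c2 _ _].
  rewrite (_ : H = (fun w => Fx w + (fun=> 'i%C) w * Fy w)); last by apply/funext => w; rewrite FHE.
  by apply: ccontD => //; apply: ccontM => //; exact: ccont_cst.
have K1 p : closed_disk r p -> normc (of_plane p) < 1.
  exact: (closed_disk_normc_lt1 (ltW r0) r1).
have ReH p : Re (H (of_plane p)) = Re (a (of_plane p)) -
     r ^+ (2 * m) * Re (b (of_plane p)).
  by rewrite /H ReD ReN ReM/= mul0r subr0.
have ImH p : Im (H (of_plane p)) = Im (a (of_plane p)) -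
     r ^+ (2 * m) * Im (b (of_plane p)).
  by rewrite /H ImD ImN ImM/= mul0r addr0.
have mK := measurable_closed_disk r.
split.
  under eq_integral do rewrite -/m -ReH.
  apply: integral_dA_eq0 => //; apply: continuous_closed_disk_integrable; first exact: ltW.
  by move=> -[x y] /K1/cH[].
under eq_integral do rewrite -/m -ImH.
apply: integral_dA_eq0 => //; apply: continuous_closed_disk_integrable; first exact: ltW.
by move=> -[x y] /K1/cH[].
Qed.

Lemma monomial_le1 (i q : nat) (z : C) : normc z < 1 ->
  normc (z ^+ i * conjc z ^+ q) <= 1.
Proof.
move=> z1; rewrite normcM -[leRHS]mulr1.
apply: ler_pM; rewrite ?normc_ge0//; apply: normc_monomial_le1 => //.
by rewrite normc_conj.
Qed.

Lemma L2_monomial (i q : nat) : L2 (fun z : C => z ^+ i * conjc z ^+ q).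
Proof.
apply: (@L2_bounded _ _ 1).
  apply: cmeasurable_ccont => z _.
  by apply: ccontM; apply: ccontX; [exact: ccont_id|exact: ccont_conj].
move=> z; exact: monomial_le1.
Qed.

Lemma is_bergman_proj_monomial (i q : nat) :
  is_bergman_proj (fun z : C => z ^+ i * conjc z ^+ q)
    (fun z => proj_coef i q * z ^+ (i - q)).
Proof.
split; first exact: bergman_scale (bergman_monomial _ _).
move=> u [Lu an].
pose a z := z ^+ q * conjc z ^+ i * u z.
pose b z := proj_coef i q * conjc z ^+ (i - q) * u z.
have c1 w : conjc (R := R) (proj_coef i q * w) = proj_coef i q * conjc w.
  by rewrite rmorphM/= /proj_coef fmorph_div/= !rmorph_nat.
have E z : (z ^+ i * conjc z ^+ q - proj_coef i q * z ^+ (i - q)) * conjc (u z) =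
    conjc (a z - b z).
  have ca : conjc (z ^+ q * conjc z ^+ i) = z ^+ i * conjc z ^+ q.
    by rewrite rmorphM !rmorphXn/= conjcK mulrC.
  have cb : conjc (proj_coef i q * conjc z ^+ (i - q)) = proj_coef i q * z ^+ (i - q).
    by rewrite c1 rmorphXn/= conjcK.
  by rewrite /a /b -mulrBl rmorphM/= rmorphB/= ca cb.
have iL f : L2 f -> cintegrable f.
  move=> Lf; have [i1 i2] := L2_mul_integrable Lf (L2_cst 1).
  have e1 w : w * conjc (1 : C) = w by rewrite rmorph1 mulr1.
  by split; [move: i1|move: i2]; apply: eq_integrable (mD) _ _ _ => p _; rewrite /= e1.
have La : L2 a.
  apply: (@L2_mul_bounded _ _ _ 1) => //; first by case: (L2_monomial q i).
  by move=> z z1; exact: monomial_le1.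
have Lb : L2 b.
  have Lu' : L2 (fun z => conjc z ^+ (i - q) * u z).
    apply: (@L2_mul_bounded _ _ _ 1) => //.
      by apply: cmeasurable_ccont => z _; apply: ccontX; exact: ccont_conj.
    by move=> z z1; apply: normc_monomial_le1; rewrite normc_conj.
  apply: L2_ext (L2_lin (proj_coef i q) Lu' (L2_cst 0)).
  by move=> z _; rewrite addr0 /b mulrA.
have [Ra Ia] := iL a La; have [Rb Ib] := iL b Lb.
have [RI II] : (\int[dA]_(p in D) (Re (a (of_plane p)) - Re (b (of_plane p)))%:E = 0)%E /\
    (\int[dA]_(p in D) (Im (a (of_plane p)) - Im (b (of_plane p)))%:E = 0)%E.
  split; apply: (@integral_disk_exhaustion _ _ (2 * minn q i.+1)) => // r r0 r1.
    by have [] := integral_closed_disk_monomial i q an r0 r1.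
  by have [] := integral_closed_disk_monomial i q an r0 r1.
rewrite /inner (@cintegral_ext _ _ (fun z => conjc (a z - b z))); last first.
  by move=> z _; exact: E.
rewrite /cintegral /Rintegral.
have -> : (\int[dA]_(p in D) (Re (conjc (a (of_plane p) - b (of_plane p))))%:E = 0)%E.
  by rewrite -RI; apply: eq_integral => p _; rewrite Re_conj ReD ReN.
have -> : (\int[dA]_(p in D) (Im (conjc (a (of_plane p) - b (of_plane p))))%:E = 0)%E.
  transitivity (\int[dA]_(p in D) ((-1)%:E * (Im (a (of_plane p)) - Im (b (of_plane p)))%:E))%E.
    by apply: eq_integral => p _; rewrite Im_conj ImD ImN -EFinM; congr EFin; ring.
  rewrite integralZl ?II ?mule0//; first exact: mD.
  have := integrableB mD Ia Ib; exact.
by [].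
Qed.

End MonomialProjection.

(** * Commuting slant matrices *)

Section SlantMatrices.
Variable F : numFieldType.
Implicit Types (a b : nat -> F) (j q s : nat).

(** The entry of the slant little Hankel operator: the coefficient of [z ^ j]
    in the image of [z ^ q]. *)
Definition slant_entry (k : nat) a j q : F :=
  a (k * j + q)%N * ((k * j).+1%:R / (k * j + q).+1%:R).

(** Commutation of the matrices truncated to indices at most [n], which loses
    nothing for symbols of degree at most [n]. *)
Definition slant_commute (k n : nat) a b : Prop :=
  forall j q, (j <= n)%N -> (q <= n)%N ->
    \sum_(s < n.+1) slant_entry k a j s * slant_entry k b s q =
    \sum_(s < n.+1) slant_entry k b j s * slant_entry k a s q.

Lemma slant_entry_eq0 k a j q : a (k * j + q)%N = 0 -> slant_entry k a j q = 0.
Proof. by rewrite /slant_entry => ->; rewrite mul0r. Qed.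

Lemma slant_entry_neq0 k a j q : a (k * j + q)%N != 0 ->
  slant_entry k a j q != 0.
Proof. by move=> a0; rewrite mulf_neq0// mulf_neq0// ?invr_eq0 pnatr_eq0. Qed.

Lemma slant_entry0_eq0 k a q : slant_entry k a 0 q = 0 -> a q = 0.
Proof.
by move=> h; apply/eqP/negP => /negP aq; have := @slant_entry_neq0 k a 0 q; rewrite muln0 add0n h eqxx => /(_ aq).
Qed.

Lemma slant_entryD k a b (l : F) j q :
  slant_entry k (fun i => a i + l * b i) j q =
  slant_entry k a j q + l * slant_entry k b j q.
Proof. by rewrite /slant_entry mulrDl mulrA. Qed.

Lemma slant_commuteD k n a b (l : F) : slant_commute k n a b ->
  slant_commute k n (fun i => a i + l * b i) b.
Proof.
move=> ab j q jn qn.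
under eq_bigr do rewrite slant_entryD mulrDl -mulrA.
under [RHS]eq_bigr do rewrite slant_entryD mulrDr [X in _ + X]mulrCA.
rewrite !big_split/= -!mulr_sumr.
by rewrite (ab j q jn qn).
Qed.

(** When the coefficients of [a] beyond [t] vanish, column [t] of its matrix
    is reduced to its topmost entry, a nonzero multiple of [a t]. The entry
    [(j, t)] of the product with the matrix of [b] on the left is then this
    entry times a nonzero multiple of [b (k * j)]. *)
Lemma slant_top_coef k n a b j t : (0 < k)%N -> slant_commute k n a b ->
  (j <= n)%N -> (t <= n)%N -> b (k * j)%N != 0 ->
  (forall i, (t < i)%N -> a i = 0) ->
  (forall s, slant_entry k a j s * slant_entry k b s t = 0) -> a t = 0.
Proof.
move=> k0 ab jn tn bj at0 ab0; have := ab j t jn tn.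
rewrite big1 => [|s _]; last exact: ab0.
rewrite big_ord_recl big1 => [|s _]; last first.
  by rewrite [X in _ * X]slant_entry_eq0 ?mulr0// at0// lift0; nia.
move=> /esym/eqP; rewrite addr0 mulf_eq0 => /orP[|/eqP/slant_entry0_eq0//].
move=> /eqP h; have := @slant_entry_neq0 k b j 0.
by rewrite addn0 bj h eqxx => /(_ isT).
Qed.

Lemma downward_vanish (a : nat -> F) (n l : nat) :
  (forall i, (n < i)%N -> a i = 0) ->
  (forall t, (l <= t <= n)%N -> (forall i, (t < i)%N -> a i = 0) -> a t = 0) ->
  forall i, (l <= i)%N -> a i = 0.
Proof.
move=> an step.
suff H d i : (l <= i)%N -> (n < i + d)%N -> a i = 0.
  by move=> i li; apply: (H n.+1) => //; rewrite addnS ltnS leq_addl.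
elim: d i => [|d IH] i li; first by rewrite addn0; exact: an.
move=> nid; have [ni|ni] := ltnP n i; first exact: an.
apply: step; first by rewrite li.
by move=> i' ii'; apply: IH; lia.
Qed.

(** Row [p] is used throughout, because [b (k * p)] is nonzero: first to kill
    the coefficients of [a] beyond [m], then those of the combination [a'] of
    [a] and [b] whose coefficient of index [m] is zero. *)
Lemma slant_commute_multiple k n m p a b : (0 < k)%N -> (m < n)%N ->
  (k * p <= m)%N -> (m < k * p + k)%N ->
  b (k * p)%N != 0 -> b m != 0 ->
  (forall i, (n < i)%N -> a i = 0) -> (forall i, (m < i)%N -> b i = 0) ->
  slant_commute k n a b -> forall i, a i = a m / b m * b i.
Proof.
move=> k0 mn pm mp bkp bm an bm0 ab.
have pn : (p <= n)%N by nia.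
have am : forall i, (m < i)%N -> a i = 0.
  apply: (@downward_vanish _ n) => // t /andP[mt tn] at0.
  apply: (slant_top_coef k0 ab pn tn bkp at0) => s.
  by rewrite [X in _ * X]slant_entry_eq0 ?mulr0// bm0//; lia.
pose a' i := a i + - (a m / b m) * b i.
have ab' : slant_commute k n a' b by exact: slant_commuteD.
have a'm i : (m <= i)%N -> a' i = 0.
  rewrite leq_eqVlt /a' => /predU1P[<-|mi]; first by rewrite mulNr divfK// subrr.
  by rewrite (am i mi) (bm0 i mi) mulr0 addr0.
(* column [m] of [b] is supported at the top, and that of [a'] is zero *)
have a'kp : a' (k * p)%N = 0.
  have := ab' p m pn (ltnW mn); rewrite [RHS]big1 => [|s _]; last first.
    by rewrite [X in _ * X]slant_entry_eq0 ?mulr0// a'm//; lia.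
  rewrite big_ord_recl big1 => [|s _]; last first.
    by rewrite [X in _ * X]slant_entry_eq0 ?mulr0// bm0// lift0; nia.
  rewrite addr0 => /eqP; rewrite mulf_eq0 orbC.
  have /negPf -> /= : slant_entry k b 0 m != 0 by apply: slant_entry_neq0; rewrite muln0.
  move=> /eqP h; apply/eqP/negP => /negP a'0.
  have := @slant_entry_neq0 k a' p 0.
  by rewrite addn0 a'0 h eqxx => /(_ isT).
suff a'0 i : a' i = 0.
  by move=> i; apply/eqP; rewrite -subr_eq0 -mulNr; apply/eqP; exact: a'0.
apply: (@downward_vanish a' m 0) => // [{}i /ltnW/a'm//|t /= tm a't].
apply: (slant_top_coef k0 ab' pn _ bkp a't); first by lia.
case=> [|s]; first by rewrite slant_entry_eq0 ?mul0r// addn0.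
(* either the index [k * p + s.+1] exceeds [t], or [k * s.+1 + t] exceeds [m],
   which is less than [k * p + k] *)
have [st|st] := ltnP t (k * p + s.+1).
  by rewrite slant_entry_eq0 ?mul0r// a't.
by rewrite [X in _ * X]slant_entry_eq0 ?mulr0// bm0//; nia.
Qed.

End SlantMatrices.

(** * Slant little Hankel operators on polynomials *)

Section SlantOperators.
Variable R : realType.
Local Notation C := R[i].
Local Notation normc := (@normc R).
Implicit Types (a b c : nat -> C) (f g h u : C -> C).

Definition lin_comb (N : nat) (c : nat -> C) (f : nat -> C -> C) : C -> C :=
  fun z => \sum_(0 <= i < N) c i * f i z.

Lemma lin_combS N c (f : nat -> C -> C) :
  lin_comb N.+1 c f = fun z => c N * f N z + lin_comb N c f z.
Proof. by apply/funext => z; rewrite /lin_comb big_nat_recr//= addrC. Qed.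

Lemma lin_comb0 c (f : nat -> C -> C) : lin_comb 0 c f = fun=> 0.
Proof. by apply/funext => z; rewrite /lin_comb big_geq. Qed.

Lemma bergman_lin_comb N c (f : nat -> C -> C) : (forall i, bergman (f i)) ->
  bergman (lin_comb N c f).
Proof.
move=> bf; elim: N => [|N IH]; first by rewrite lin_comb0; exact: bergman0.
by rewrite lin_combS; exact (bergman_lin (c N) (bf N) IH).
Qed.

Lemma L2_lin_comb N c (f : nat -> C -> C) : (forall i, L2 (f i)) -> L2 (lin_comb N c f).
Proof.
move=> bf; elim: N => [|N IH]; first by rewrite lin_comb0; exact: L2_cst.
by rewrite lin_combS; exact (L2_lin (c N) (bf N) IH).
Qed.

Lemma is_bergman_proj_lin_comb N c (g h : nat -> C -> C) : (forall i, L2 (g i)) ->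
  (forall i, is_bergman_proj (g i) (h i)) ->
  is_bergman_proj (lin_comb N c g) (lin_comb N c h).
Proof.
move=> Lg gh; elim: N => [|N IH].
  by rewrite !lin_comb0; exact: is_bergman_proj0.
rewrite !lin_combS; apply: is_bergman_proj_lin => //; exact: L2_lin_comb.
Qed.

Lemma conj_conjcK (z : C) : Num.conj (conjc z) = z.
Proof. exact: conjcK. Qed.

Lemma L2_conj_poly_mul n a f : L2 f -> L2 (Jop (Mop (conj_poly n a) f)).
Proof.
move=> Lf; apply: L2_Jop.
apply: (@L2_mul_bounded _ _ _ (\sum_(0 <= i < n.+1) normc (a i))) => //.
  apply: cmeasurable_ccont => z _; rewrite /conj_poly.
  elim: n.+1 => [|N IH].
    rewrite (_ : (fun _ => _) = fun=> 0); first exact: ccont_cst.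
    by apply/funext => w; rewrite big_geq.
  rewrite (_ : (fun _ => _) = (fun w => (\sum_(0 <= i < N) a i * Num.conj w ^+ i)
      + (fun=> a N) w * conjc w ^+ N)).
    by apply: ccontD => //; apply: ccontM; [exact: ccont_cst|apply: ccontX; exact: ccont_conj].
  by apply/funext => w; rewrite big_nat_recr.
move=> z z1; rewrite /conj_poly (le_trans (normc_sum _ _))//.
apply: ler_sum => i _; rewrite normcM ler_piMr ?normc_ge0//.
by apply: normc_monomial_le1; rewrite normc_conj.
Qed.

(** The image of [z ^ q] under the little Hankel operator. *)
Definition hankel_monomial n a q : C -> C :=
  lin_comb n.+1 a (fun i z => proj_coef R i q * z ^+ (i - q)).

Lemma bergman_hankel_monomial n a q : bergman (hankel_monomial n a q).
Proof.
by apply: bergman_lin_comb => i; apply: bergman_scale; exact: bergman_monomial.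
Qed.

Lemma is_bergman_proj_hankel_monomial n a q :
  is_bergman_proj (Jop (Mop (conj_poly n a) (fun z => z ^+ q)))
    (hankel_monomial n a q).
Proof.
rewrite (_ : Jop _ = lin_comb n.+1 a (fun i z => z ^+ i * conjc z ^+ q)).
  apply: is_bergman_proj_lin_comb => i; first exact: L2_monomial.
  exact: is_bergman_proj_monomial.
apply/funext => z; rewrite /Jop /Mop /conj_poly /lin_comb mulr_suml.
by apply: eq_bigr => i _; rewrite conj_conjcK mulrA.
Qed.

Lemma little_hankel_ext phi f g : eq_disk f g ->
  little_hankel phi f = little_hankel phi g.
Proof.
move=> fg; apply: bergman_proj_ext => z z1.
by rewrite /Jop /Mop fg// normc_conj.
Qed.

Lemma little_hankel_poly n a N c :
  eq_disk (little_hankel (conj_poly n a) (lin_comb N c (fun q z => z ^+ q)))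
    (lin_comb N c (hankel_monomial n a)).
Proof.
have Lm q := L2_conj_poly_mul n a (bergman_monomial R q).1.
have E : Jop (Mop (conj_poly n a) (lin_comb N c (fun q z => z ^+ q))) =
    lin_comb N c (fun q => Jop (Mop (conj_poly n a) (fun z => z ^+ q))).
  apply/funext => z; rewrite /Jop /Mop /lin_comb mulr_sumr.
  by apply: eq_bigr => i _; rewrite mulrCA.
rewrite /little_hankel E; apply: bergman_projP; first exact: L2_lin_comb.
apply: is_bergman_proj_lin_comb => // q.
exact: is_bergman_proj_hankel_monomial.
Qed.

Section Slant.
Variables (k : nat) (W : (C -> C) -> (C -> C)).
Hypothesis k2 : (2 <= k)%N.
Hypothesis hW : is_slant k W.

Lemma slant_lin (c : C) f g : bergman f -> bergman g ->
  eq_disk (W (fun z => c * f z + g z)) (fun z => c * W f z + W g z).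
Proof.
by move=> bf bg z z1; case: hW => -[_ lin _] _ _; apply: lin => //; apply/mem_set/unit_diskE.
Qed.

Lemma slant_bergman f : bergman f -> bergman (W f).
Proof. by case: hW => -[bW _ _] _ _; exact: bW. Qed.

Lemma slant0 : eq_disk (W (fun=> 0)) (fun=> 0).
Proof.
move=> z z1; have b0 := bergman0 R.
have := slant_lin (-1) b0 b0 z1.
rewrite (_ : (fun _ => _) = fun=> 0); first by move=> ->; rewrite mulN1r addNr.
by apply/funext => w; rewrite mulr0 addr0.
Qed.

(** The bound on the operator is what makes it blind to the values off the
    disk: functions that agree on the disk differ by one of norm zero. *)
Lemma slant_ext f g : bergman f -> bergman g -> eq_disk f g ->
  eq_disk (W f) (W g).
Proof.
move=> bf bg fg.
pose h z := -1 * g z + f z.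
have bh : bergman h by exact: bergman_lin.
have h0 : eq_disk h (fun=> 0) by move=> z z1; rewrite /h fg//; ring.
have Nh : L2norm h = 0.
  rewrite /L2norm (inner_ext h0 h0) Re_inner_self.
  rewrite (_ : Rintegral _ _ _ = 0) ?sqrtr0//.
  by rewrite /Rintegral integral0_eq// => p _; rewrite normc0 expr0n.
have bWh := slant_bergman bh.
have Wh0 : eq_disk (W h) (fun=> 0).
  case: hW => -[_ _ [M HM]] _ _.
  apply: (bergman_inner_self_eq0 bWh); apply/eqP.
  rewrite eq_le; apply/andP; split.
    have := HM h bh; rewrite Nh mulr0 /L2norm.
    have := sqrtr_ge0 (complex.Re (inner (W h) (W h))) => s0 s1.
    by rewrite -sqrtr_eq0 eq_le s1 s0.
  rewrite Re_inner_self; apply: Rintegral_ge0 => p _; exact: sqr_ge0.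
move=> z z1; have := slant_lin (-1) bg bf z1.
by rewrite Wh0// mulN1r addrC => /esym/eqP; rewrite subr_eq0 => /eqP.
Qed.

Lemma slant_scale (c : C) f : bergman f ->
  eq_disk (W (fun z => c * f z)) (fun z => c * W f z).
Proof.
move=> bf z z1; have b0 := bergman0 R.
have := slant_lin c bf b0 z1; rewrite slant0// addr0 => <-.
apply: slant_ext z1; [exact: bergman_scale|exact: bergman_lin|].
by move=> w _; rewrite addr0.
Qed.

Lemma slant_lin_comb N c (f : nat -> C -> C) : (forall i, bergman (f i)) ->
  eq_disk (W (lin_comb N c f)) (lin_comb N c (fun i => W (f i))).
Proof.
move=> bf; elim: N => [|N IH].
  by rewrite !lin_comb0; exact: slant0.
rewrite !lin_combS => z z1; rewrite slant_lin// ?IH//.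
exact: bergman_lin_comb.
Qed.

Definition slant_monomial e : C -> C :=
  fun z => if (k %| e)%N then z ^+ (e %/ k) else 0.

Lemma slant_monomialE e : eq_disk (W (fun z => z ^+ e)) (slant_monomial e).
Proof.
move=> z z1; have zd : z \in @unit_disk R by apply/mem_set/unit_diskE.
case: hW => _ W1 W2; rewrite /slant_monomial; case: ifPn => [/dvdnP[q ->]|ke].
  by rewrite mulnK; [rewrite mulnC; exact: W1|lia].
rewrite [in LHS](divn_eq e k) mulnC; apply: W2 => //.
rewrite lt0n ke/=; have := ltn_pmod e (ltnW k2); lia.
Qed.

Lemma slant_hankel_monomial n a q : (forall i, (n < i)%N -> a i = 0) ->
  eq_disk (W (hankel_monomial n a q))
    (lin_comb n.+1 (fun j => slant_entry k a j q) (fun j z => z ^+ j)).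
Proof.
move=> an z z1.
rewrite slant_lin_comb//; last first.
  by move=> i; apply: bergman_scale; exact: bergman_monomial.
rewrite /lin_comb.
transitivity (\sum_(0 <= i < n.+1) \sum_(0 <= j < n.+1)
    if i == (k * j + q)%N then slant_entry k a j q * z ^+ j else 0).
  rewrite big_nat [RHS]big_nat; apply: eq_bigr => i /andP[_ iN].
  rewrite slant_scale//; last exact: bergman_monomial.
  rewrite slant_monomialE// /slant_monomial.
  have k0 : (0 < k)%N by lia.
  have [qi|iq] := leqP q i; last first.
    rewrite big1; last by move=> j _; case: eqP => //; lia.
    rewrite /proj_coef (_ : (i.+1 - q = 0)%N) ?mul0r ?mulr0//; lia.
  case: ifPn => [/dvdnP[j ij]|nd]; last first.
    rewrite big1 ?mulr0// => j _; case: eqP => // ij; move: nd.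
    by rewrite ij addnK dvdn_mulr.
  rewrite ij mulnK//.
  have jn : (j < n.+1)%N by nia.
  rewrite (bigD1_seq j) ?mem_index_iota ?iota_uniq//=.
  have iE : i = (k * j + q)%N by lia.
  rewrite iE eqxx big1 ?addr0; last first.
    by move=> j' jj'; case: eqP => // h; case/eqP: jj'; nia.
  rewrite /slant_entry /proj_coef mulrA; congr (_ * _ * _).
  by rewrite -addSn addnK.
rewrite exchange_big/=; apply: eq_bigr => j _.
have [kj|kj] := leqP (k * j + q) n.
  rewrite (bigD1_seq (k * j + q)%N) ?mem_index_iota ?iota_uniq//=.
  by rewrite eqxx big1 ?addr0// => i /negPf ->.
rewrite slant_entry_eq0 ?an// mul0r big1_seq// => i /=.
by rewrite mem_index_iota => /andP[_ iN]; case: eqP => //; lia.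
Qed.

Lemma slant_little_hankel_poly n a N c : (forall i, (n < i)%N -> a i = 0) ->
  eq_disk (slant_little_hankel W (conj_poly n a) (lin_comb N c (fun q z => z ^+ q)))
    (lin_comb n.+1 (fun j => \sum_(0 <= q < N) slant_entry k a j q * c q)
       (fun j z => z ^+ j)).
Proof.
move=> an; rewrite /slant_little_hankel => z z1.
rewrite (slant_ext _ _ (little_hankel_poly n a N c))//; last 2 first.
- exact: bergman_bergman_proj.
- by apply: bergman_lin_comb => q; exact: bergman_hankel_monomial.
rewrite slant_lin_comb//; last by move=> q; exact: bergman_hankel_monomial.
rewrite /lin_comb; under eq_bigr do rewrite slant_hankel_monomial// /lin_comb mulr_sumr.
rewrite exchange_big/=; apply: eq_bigr => j _.
by rewrite mulr_suml; apply: eq_bigr => q _; ring.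
Qed.

Lemma slant_little_hankel_ext phi f g : eq_disk f g ->
  slant_little_hankel W phi f = slant_little_hankel W phi g.
Proof.
by move=> fg; rewrite /slant_little_hankel (little_hankel_ext phi fg).
Qed.

(** Homogeneity in both arguments: [h] is the image of a function under a
    multiple of the symbol, or of a multiple of the function. *)
Lemma slant_proj_scale (l : C) g h : L2 g -> eq_disk h (fun z => l * g z) ->
  eq_disk (W (bergman_proj h)) (fun z => l * W (bergman_proj g) z).
Proof.
move=> Lg hg z z1; rewrite (bergman_proj_ext hg).
have b1 := bergman_bergman_proj g.
have b2 := bergman_bergman_proj (fun z => l * g z).
rewrite (slant_ext b2 (bergman_scale l b1) (bergman_projZ l Lg) z1).
exact: slant_scale b1 z z1.
Qed.

Lemma slant_commute_of_multiple n m a b (l : C) :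
  eq_disk (conj_poly n a) (fun z => l * conj_poly m b z) ->
  commute_on_bergman (slant_little_hankel W (conj_poly n a))
    (slant_little_hankel W (conj_poly m b)).
Proof.
move=> ab f bf z /set_mem/unit_diskE z1.
pose S g := slant_little_hankel W (conj_poly m b) g.
have Sab g : bergman g -> eq_disk (slant_little_hankel W (conj_poly n a) g)
    (fun z => l * S g z).
  move=> [Lg _]; apply: slant_proj_scale; first exact: L2_conj_poly_mul.
  by move=> w w1; rewrite /Jop /Mop ab ?normc_conj// mulrA.
have bS : bergman (S f) by exact: slant_bergman (bergman_bergman_proj _).
rewrite (Sab _ bS z z1); apply/esym.
apply: (slant_proj_scale (L2_conj_poly_mul m b bS.1) _ z1) => w w1.
rewrite /Jop /Mop (Sab f bf) ?normc_conj//; ring.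
Qed.

End Slant.
End SlantOperators.

(** * Commuting slant little Hankel operators *)

Lemma sum_kronecker (A : pzRingType) (f : nat -> A) (n q : nat) : (q <= n)%N ->
  \sum_(0 <= i < n.+1) f i * (i == q)%:R = f q.
Proof.
move=> qn; rewrite (bigD1_seq q) ?mem_index_iota ?iota_uniq//=.
by rewrite eqxx mulr1 big1 ?addr0// => i /negPf ->; rewrite mulr0.
Qed.

Section CommutingSlants.
Variable R : realType.
Local Notation C := R[i].
Local Notation normc := (@normc R).
Local Notation monomial := (fun (i : nat) (z : C) => z ^+ i).
Implicit Types (a b c d : nat -> C).

Lemma lin_comb_monomial_inj N c d :
  eq_disk (lin_comb N c monomial) (lin_comb N d monomial) ->
  forall j, (j < N)%N -> c j = d j.
Proof.
move=> cd j jN; pose p : {poly C} := \poly_(i < N) (c i - d i).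
suff p0 : p = 0.
  have := coef_poly N (fun i => c i - d i) j; rewrite -/p p0 coef0 jN.
  by move=> /esym/eqP; rewrite subr_eq0 => /eqP.
have pz z : normc z < 1 -> root p z.
  move=> /cd; rewrite /lin_comb !big_mkord => E.
  rewrite rootE horner_poly.
  under eq_bigr do rewrite mulrBl.
  by rewrite sumrB E subrr.
apply/eqP/negP => /negP p0.
pose x (i : nat) : C := (i.+2%:R^-1 : R)%:C.
have x1 i : normc (x i) < 1.
  by rewrite normcR ?invr_ge0// invf_lt1// ltr1n.
have xinj : injective x.
  move=> i i' /complexI/invr_inj/eqP; rewrite eqr_nat => /eqP; lia.
have := @max_poly_roots _ p [seq x i | i <- iota 0 (size p)] p0.
rewrite size_map size_iota ltnn map_inj_uniq ?iota_uniq// => /(_ _ isT).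
by move=> /(_ _)/negP; apply => //; apply/allP => z /mapP[i _ ->]; exact: pz.
Qed.

Variables (k : nat) (W : (C -> C) -> (C -> C)).
Hypothesis k2 : (2 <= k)%N.
Hypothesis hW : is_slant k W.
Local Notation S n a := (slant_little_hankel W (conj_poly n a)).

Lemma slant_little_hankel_monomial n a q : (q <= n)%N ->
  (forall i, (n < i)%N -> a i = 0) ->
  eq_disk (S n a (monomial q))
    (lin_comb n.+1 (fun j => slant_entry k a j q) monomial).
Proof.
move=> qn an; pose e (i : nat) : C := (i == q)%:R.
have E : eq_disk (monomial q) (lin_comb n.+1 e monomial).
  move=> z _; rewrite /lin_comb -[LHS](sum_kronecker (fun i => z ^+ i) qn).
  by apply: eq_bigr => i _; rewrite mulrC.
rewrite (slant_little_hankel_ext _ _ E) => z z1.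
rewrite (slant_little_hankel_poly k2 hW n.+1 e an z1).
apply: eq_bigr => j _; congr (_ * _).
exact: sum_kronecker.
Qed.

Lemma slant_product_monomial n a b q : (q <= n)%N ->
  (forall i, (n < i)%N -> a i = 0) -> (forall i, (n < i)%N -> b i = 0) ->
  eq_disk (S n a (S n b (monomial q)))
    (lin_comb n.+1 (fun j => \sum_(s < n.+1)
       slant_entry k a j s * slant_entry k b s q) monomial).
Proof.
move=> qn an bn.
rewrite (slant_little_hankel_ext _ _ (slant_little_hankel_monomial qn bn)).
move=> z z1; rewrite (slant_little_hankel_poly k2 hW n.+1 _ an z1).
by apply: eq_bigr => j _; rewrite big_mkord.
Qed.

Lemma slant_commute_matrices n a b :
  (forall i, (n < i)%N -> a i = 0) -> (forall i, (n < i)%N -> b i = 0) ->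
  commute_on_bergman (S n a) (S n b) -> slant_commute k n a b.
Proof.
move=> an bn ab j q jn qn.
apply: (@lin_comb_monomial_inj n.+1 (fun j => \sum_(s < n.+1)
    slant_entry k a j s * slant_entry k b s q) (fun j => \sum_(s < n.+1)
    slant_entry k b j s * slant_entry k a s q) _ j jn) => z z1.
have Eab := slant_product_monomial qn an bn z1.
have Eba := slant_product_monomial qn bn an z1.
apply: (etrans (esym Eab) (etrans _ Eba)); apply: ab.
  exact: bergman_monomial.
exact/mem_set/unit_diskE.
Qed.

(** Padding with zeros lets two symbols of different degrees be handled as
    symbols of the same formal degree. *)
Definition truncate (n : nat) a (i : nat) : C := if (i <= n)%N then a i else 0.

Lemma conj_poly_truncate n m a : (m <= n)%N ->
  conj_poly m a = conj_poly n (truncate m a).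
Proof.
move=> mn; apply/funext => z; rewrite /conj_poly.
rewrite [RHS](@big_cat_nat _ _ _ m.+1)//= [X in _ = _ + X]big_nat_cond.
rewrite [X in _ = _ + X]big1 ?addr0.
  by apply: eq_big_nat => i /andP[_ im]; rewrite /truncate -ltnS im.
by move=> i /andP[/andP[mi _] _]; rewrite /truncate leqNgt mi mul0r.
Qed.

Lemma lin_dependent_multiple f g : lin_dependent f g ->
  (exists l : C, eq_disk f (fun z => l * g z)) \/
  (exists l : C, eq_disk g (fun z => l * f z)).
Proof.
move=> [c [d [cd0 fg]]].
have [c0|c0] := eqVneq c 0.
  right; exists 0 => z /unit_diskE/fg; rewrite c0 !mul0r add0r.
  have d0 : d != 0 by apply/eqP => d0; apply: cd0; rewrite c0 d0.
  by move=> /eqP; rewrite mulf_eq0 (negPf d0) => /eqP.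
left; exists (- d / c) => z /unit_diskE/fg/eqP; rewrite addr_eq0 => /eqP E.
by apply: (mulfI c0); rewrite E !mulNr mulrN mulrA mulrCA mulfV// mulr1.
Qed.

End CommutingSlants.

Theorem theorem3p3 (R : realType) (k n m p1 r1 p2 r2 : nat)
    (a b : nat -> R[i]%C) (W : (R[i]%C -> R[i]%C) -> (R[i]%C -> R[i]%C))
    (hk : (2 <= k)%N) (hmn : (m < n)%N)
    (hphi : Linfty (conj_poly n a)) (hzeta : Linfty (conj_poly m b))
    (hn : n = (k * p1 + r1)%N) (hr1 : (r1 < k)%N)
    (hm : m = (k * p2 + r2)%N) (hr2 : (r2 < k)%N)
    (hbkp2 : b (k * p2)%N <> 0%R) (hbm : b m <> 0%R)
    (hW : is_slant k W) :
  commute_on_bergman (slant_little_hankel W (conj_poly n a))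
                     (slant_little_hankel W (conj_poly m b))
  <-> lin_dependent (conj_poly n a) (conj_poly m b).
Proof.
split => [|/lin_dependent_multiple[] [l lE]]; last 2 first.
- exact (slant_commute_of_multiple hW lE).
- move=> f bf z zd; exact (esym (slant_commute_of_multiple hW lE bf zd)).
rewrite (conj_poly_truncate a (leqnn n)) (conj_poly_truncate b (ltnW hmn)).
set a' := truncate n a; set b' := truncate m b => ab.
have a'0 i : (n < i)%N -> a' i = 0 by rewrite /a' /truncate ltnNge => /negPf ->.
have b'0 i : (m < i)%N -> b' i = 0 by rewrite /b' /truncate ltnNge => /negPf ->.
have mat : slant_commute k n a' b'.
  by apply: (slant_commute_matrices hk hW) => // i /(ltn_trans hmn); exact: b'0.
have a'E : forall i, a' i = a' m / b' m * b' i.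
  apply: (@slant_commute_multiple _ k n m p2) => //; try lia.
    by rewrite /b' /truncate (_ : (k * p2 <= m)%N); [exact/eqP|lia].
  by rewrite /b' /truncate leqnn; exact/eqP.
exists 1, (- (a' m / b' m)); split; first by case=> /eqP; rewrite oner_eq0.
move=> z _; rewrite /conj_poly mul1r mulr_sumr -big_split big1// => i _.
rewrite /= (a'E i); move: (a' m / b' m) => l; ring.
Qed.
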